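(* Let $U\subset\mathbb{R}^N$ be open, $s>0$, $\beta>0$, and $u\in C^{2s+\beta}(U)\cap\mathcal{L}^1_s$. Then $L_{m,s}u=L_{n,s}u$ in $U$ for all $n,m\in\mathbb{N}$ such that $m>n>s$.
   Context: $N\in\mathbb{N}=\{1,2,\ldots\}$ is the dimension. Functions are real-valued on $\mathbb{R}^N$. For $m\in\mathbb{N}$, $\delta_m u(x,y):=\sum_{k=-m}^m(-1)^k\binom{2m}{m-k}u(x+ky)$. For $s\in(0,m)$, $$L_{m,s}u(x):=\frac{c_{N,m,s}}{2}\int_{\mathbb{R}^N}\frac{\delta_m u(x,y)}{|y|^{N+2s}}\,dy,$$ where $$c_{N,m,s}:=\frac{4^s\Gamma(\frac N2+s)}{\pi^{N/2}\Gamma(-s)}\Big(\sum_{k=1}^m(-1)^k\binom{2m}{m-k}k^{2s}\Big)^{-1}\quad\text{if }s\in(0,m)\setminus\mathbb{N},$$ $$c_{N,m,s}:=\frac{4^s\Gamma(\frac N2+s)\,s!}{2\pi^{N/2}}\Big(\sum_{k=2}^m(-1)^{k-s+1}\binom{2m}{m-k}k^{2s}\ln(k)\Big)^{-1}\quad\text{if }s\in\{1,\ldots,m-1\}.$$ $\mathcal{L}^1_s:=\{u\in L^1_{loc}(\mathbb{R}^N):\int_{\mathbb{R}^N}\frac{|u(x)|}{1+|x|^{N+2s}}dx<\infty\}$. For $t=k+\tau$ with $k\in\mathbb{N}_0=\mathbb{N}\cup\{0\}$, $\tau\in(0,1]$ and $U$ open, $C^t(U)$ is the space of functions that are $k$-times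 continuously differentiable in $U$ with derivatives of order $k$ locally $\tau$-Hölder continuous in $U$ (locally Lipschitz if $\tau=1$). *)

(* Defs.v *)
From HB Require Import structures.
From mathcomp Require Import all_boot all_order all_algebra.
From mathcomp Require Import all_classical all_reals all_analysis.

Set Implicit Arguments.
Unset Strict Implicit.
Unset Printing Implicit Defensive.

Import Order.TTheory GRing.Theory Num.Theory.
Import numFieldNormedType.Exports.

Local Open Scope classical_set_scope.
Local Open Scope ring_scope.

(* The ambient space R^N is 'rV[R]_N. Its library norm is the sup norm, which
   gives the right topology; |x| in the formulas is the Euclidean norm. *)
Definition enorm (R : realType) (N : nat) (x : 'rV[R]_N) : R :=
  Num.sqrt (\sum_(i < N) x ord0 i ^+ 2).

Section lebesgue_measure_rV.
Context (R : realType) (N : nat).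
Implicit Types (A : set 'rV[R]_N) (B : 'rV[R]_N * 'rV[R]_N).
Local Open Scope ereal_scope.

Definition box B : set 'rV[R]_N :=
  [set x | forall i, (B.1 ord0 i < x ord0 i <= B.2 ord0 i)%R].

Definition box_volume B : R :=
  (\prod_(i < N) Num.max 0 (B.2 ord0 i - B.1 ord0 i))%R.

Definition box_cover A : set (set nat * (nat -> 'rV[R]_N * 'rV[R]_N)) :=
  [set c | A `<=` \bigcup_(k in c.1) box (c.2 k)].

Definition lebesgue_outer A : \bar R :=
  ereal_inf [set \esum_(k in c.1) (box_volume (c.2 k))%:E | c in box_cover A].

Lemma box_volume_ge0 B : (0 <= box_volume B)%R.
Proof. by apply: prodr_ge0 => i _; rewrite le_max lexx. Qed.

Let box_volumeE_ge0 B : 0 <= (box_volume B)%:E.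
Proof. by rewrite lee_fin box_volume_ge0. Qed.

Lemma lebesgue_outer_ge0 A : 0 <= lebesgue_outer A.
Proof. by apply: le_ereal_inf_tmp => _ [c _ <-]; exact: esum_ge0. Qed.

Lemma lebesgue_outer0 : lebesgue_outer set0 = 0.
Proof.
apply/eqP; rewrite eq_le lebesgue_outer_ge0 andbT.
apply: ereal_inf_lbound; exists (set0, fun=> (0%R, 0%R)) => //=.
by rewrite esum_set0.
Qed.

Lemma le_lebesgue_outer :
  {homo lebesgue_outer : A1 A2 / A1 `<=` A2 >-> A1 <= A2}.
Proof.
move=> A1 A2 A12; apply: ereal_inf_le_tmp => _ [c cA <-].
by exists c => //; exact: subset_trans cA.
Qed.

Lemma lebesgue_outer_sigma_subadditive : sigma_subadditive lebesgue_outer.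
Proof.
move=> A; have [[i ioo]|] := pselect (exists i, lebesgue_outer (A i) = +oo).
  rewrite (eseries_pinfty _ _ ioo) ?leey// => n _.
  by rewrite -ltNye (lt_le_trans _ (lebesgue_outer_ge0 _)).
rewrite -forallNE => Aoo.
suff add2e (e : {posnum R}) : lebesgue_outer (\bigcup_n A n) <=
    \sum_(i <oo) lebesgue_outer (A i) + e%:num%:E.
  by apply/lee_addgt0Pr => _/posnumP[].
rewrite (le_trans _ (epsilon_trick _ _ _))//; last first.
  by move=> n; exact: lebesgue_outer_ge0.
pose v (c : set nat * (nat -> 'rV[R]_N * 'rV[R]_N)) (k : nat) :=
  (box_volume (c.2 k))%:E.
pose P n c := box_cover (A n) c /\
  \esum_(k in c.1) v c k <= lebesgue_outer (A n) + (e%:num / (2 ^ n.+1)%:R)%:E.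
have [G PG] : {G : nat -> _ & forall n, P n (G n)}.
  apply: (@choice _ _ P) => n; rewrite /P /lebesgue_outer.
  set S := (X in ereal_inf X); move infS : (ereal_inf S) => iS.
  case: iS infS => [r Sr|Soo|Soo].
  - have en1 : (0 < e%:num / (2 ^ n.+1)%:R)%R by [].
    have /(lb_ereal_inf_adherent en1) : ereal_inf S \is a fin_num by rewrite Sr.
    move=> [x [c cA] <- cx].
    by exists c; split => //; rewrite -Sr; exact/ltW.
  - by have := Aoo n; rewrite /lebesgue_outer Soo.
  - by have := lebesgue_outer_ge0 (A n); rewrite /lebesgue_outer Soo.
have /card_esym/ppcard_eqP[f] := card_nat2.
pose D := [set k | (G (f k).1).1 (f k).2].
apply: (@le_trans _ _ (\esum_(k in D) v (G (f k).1) (f k).2)).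
  apply: ereal_inf_lbound; exists (D, fun k => (G (f k).1).2 (f k).2) => //=.
  move=> t [n _ /(PG n).1[j Dj Bt]].
  by exists (f^-1%FUN (n, j)) => //=; rewrite /D /= invK ?inE.
pose w (p : nat * nat) := v (G p.1) p.2.
have -> : \esum_(k in D) v (G (f k).1) (f k).2 =
    \esum_(p in [set: nat] `*`` (fun n => (G n).1)) w p.
  rewrite (reindex_esum D _ f)//.
  split.
  - by move=> k /=.
  - by move=> x y _ _; apply: inj; rewrite inE.
  - move=> [n j] [_ /= Dj]; exists (f^-1%FUN (n, j)) => //=.
      by rewrite /D /= invK ?inE.
    by rewrite invK ?inE.
rewrite -(@esum_esum _ _ _ setT (fun n => (G n).1) (fun n j => v (G n) j)); last first.
  by move=> n j _ _; exact: box_volumeE_ge0.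
rewrite nneseries_esumT//; last first.
  by move=> n; rewrite adde_ge0 ?lebesgue_outer_ge0.
by apply: le_esum => n _; exact: (PG n).2.
Qed.

HB.instance Definition _ := isOuterMeasure.Build R 'rV[R]_N lebesgue_outer
  lebesgue_outer0 lebesgue_outer_ge0 le_lebesgue_outer
  lebesgue_outer_sigma_subadditive.

(* 'rV[R]_N with the sigma-algebra of Lebesgue measurable sets *)
Definition lebesgue_rV := caratheodory_type lebesgue_outer.
HB.instance Definition _ := Measurable.on lebesgue_rV.

Definition lebesgue_measure_rV : set lebesgue_rV -> \bar R := lebesgue_outer.
HB.instance Definition _ := isMeasure.Build _ lebesgue_rV R lebesgue_measure_rV
  (@caratheodory_measure0 R _ lebesgue_outer)
  (@caratheodory_measure_ge0 R _ lebesgue_outer)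
  (@caratheodory_measure_sigma_additive R _ lebesgue_outer).

End lebesgue_measure_rV.

Arguments lebesgue_measure_rV : clear implicits.

Section function_spaces.
Context (R : realType) (N : nat).
Implicit Types (U : set 'rV[R]_N) (f u : 'rV[R]_N -> R).

Definition iter_partial (I : seq 'I_N) f : 'rV[R]_N -> R :=
  foldr (fun i g => 'D_(delta_mx ord0 i) g) f I.

Definition Ck (k : nat) U f :=
  (forall I : seq 'I_N, (size I <= k)%N ->
     forall x, U x -> {for x, continuous (iter_partial I f)}) /\
  (forall I : seq 'I_N, (size I < k)%N ->
     forall i x, U x -> derivable (iter_partial I f) x (delta_mx ord0 i)).

Definition locally_hoelder (tau : R) U f :=
  forall x, U x -> exists C : R,
    \forall y \near x & z \near x, `|f y - f z| <= C * enorm (y - z) `^ tau.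

(* The decomposition t = k + tau is unique since 0 < tau <= 1. *)
Definition Ct (t : R) U f :=
  exists (k : nat) (tau : R),
    [/\ t = k%:R + tau, 0 < tau <= 1, Ck k U f &
        forall I : seq 'I_N, size I = k ->
          locally_hoelder tau U (iter_partial I f)].

Definition L1loc u :=
  measurable_fun [set: lebesgue_rV R N] u /\
  forall K : set 'rV[R]_N, compact K ->
    (\int[lebesgue_measure_rV R N]_(x in K) `|u x|%:E < +oo)%E.

Definition L1s (s : R) u :=
  L1loc u /\
  (\int[lebesgue_measure_rV R N]_x
     (`|u x| / (1 + enorm x `^ (N%:R + 2 * s)))%:E < +oo)%E.

End function_spaces.

(* Euler's integral, extended to the x < 0 that are not integers by
   Gamma (x + n) = x (x + 1) ... (x + n - 1) Gamma x; here n is the least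
   natural number such that 0 < x + n. *)
Definition Gamma (R : realType) (x : R) : R :=
  let n := Num.truncn (1 - x) in
  (\int[lebesgue_measure]_(t in `]0%R, +oo[) (t `^ (x + n%:R - 1) * expR (- t)))
    / \prod_(i < n) (x + i%:R).

Section hypersingular.
Context (R : realType) (N : nat).

(* The index j corresponds to k = j - m in {-m, ..., m}. *)
Definition delta (m : nat) (u : 'rV[R]_N -> R) (x y : 'rV[R]_N) : R :=
  \sum_(j < (2 * m).+1)
    let k := j%:Z - m%:Z in
    (-1) ^ k * 'C(2 * m, `|m%:Z - k|)%:R * u (x + k%:~R *: y).

Definition cNms (m : nat) (s : R) : R :=
  if s \is a Num.nat then
    let l := Num.truncn s in
    4 `^ s * Gamma (N%:R / 2 + s) * (l`!)%:R / (2 * pi `^ (N%:R / 2)) *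
    (\sum_(2 <= k < m.+1) (-1) ^ (k%:Z - l%:Z + 1) * 'C(2 * m, m - k)%:R *
       k%:R `^ (2 * s) * ln k%:R)^-1
  else
    4 `^ s * Gamma (N%:R / 2 + s) / (pi `^ (N%:R / 2) * Gamma (- s)) *
    (\sum_(1 <= k < m.+1) (-1) ^+ k * 'C(2 * m, m - k)%:R *
       k%:R `^ (2 * s))^-1.

Definition Lms (m : nat) (s : R) (u : 'rV[R]_N -> R) (x : 'rV[R]_N) : R :=
  cNms m s / 2 *
  \int[lebesgue_measure_rV R N]_y (delta m u x y / enorm y `^ (N%:R + 2 * s)).

End hypersingular.

(* Main.v *)
Require Import Defs.
From mathcomp Require Import all_boot all_order all_algebra.
From mathcomp Require Import all_classical all_reals all_analysis.
From mathcomp Require Import measurable_realfun ring lra zify.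

(** Write K = N + 2s. For every k >= 1 the scaling y |-> k y gives
    int f(k y) |y|^-K dy = k^(2s) int f(z) |z|^-K dz,
    so integrating delta_m term by term would give
    2 S_m(2s) int v(z) |z|^-K dz, where v is the even part of u around x,
    S_m(t) = sum_(1 <= k <= m) a_k k^t and a_k = (-1)^k C(2m, m - k). The
    constant c_(N,m,s) contains 1 / S_m(2s), and m disappears. The integral
    on the right diverges at 0, and the argument is made rigorous by
    subtracting from v the even homogeneous Taylor terms p_l of degree
    l <= 2s, the term of degree exactly 2s being cut off to a ball of radius
    rho. What remains of v is integrable against |z|^-K: near 0 it is
    O(|z|^(2s + beta)) up to terms of degree above 2s, and at infinity each
    p_l with l < 2s is integrable too.

    The subtracted terms of degree l < 2s cost nothing: delta_m annihilates
    polynomials of degree below 2m, that is, S_m(2j) = 0 for 0 < j < m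
    (symm_coef_moment), while the term of degree 0 compensates the central
    value of u. If s is not an integer there is no term of degree 2s, and
    the integral of delta_m is exactly 2 S_m(2s) W with W independent of m.
    If s is an integer then S_m(2s) = 0, and only the cut-off term of degree
    2s contributes. It is homogeneous of degree -N after division by |y|^K,
    so its integral over the shell rho / k < |y| <= rho is additive under
    multiplication of the k and hence proportional to ln k
    (Rintegral_log_shell); the integral of delta_m becomes a multiple,
    independent of m, of T_m = sum_k a_k k^(2s) ln k, whose inverse is in
    c_(N,m,s) for integral s. Both cases are combined in
    hypersingular_integralE.

    Cancelling the constant requires S_m(2s) <> 0, respectively T_m <> 0.
    As a function of t, S_m is a combination of m exponentials, so it has at
    most m - 1 real zeros counted with multiplicity (expsum_eq0,
    expsum_double_eq0); the m - 1 numbers 2, 4, ..., 2(m - 1) are zeros, so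
    there is no other one and each of them is simple.

    Of Lebesgue measure, the proof uses that coordinates are measurable, that
    balls have finite measure, and that y |-> x + c y multiplies the measure
    by |c|^N. *)

Import Order.TTheory GRing.Theory Num.Theory.
Import numFieldNormedType.Exports.

Local Open Scope classical_set_scope.
Local Open Scope ring_scope.

Set Implicit Arguments.
Unset Strict Implicit.
Unset Printing Implicit Defensive.

(** * Finite differences *)

(** One factor of (1 - shift)^(n+1) is applied to f first; this is Pascal's
    rule. *)
Lemma alt_binomial_sumS (R : comNzRingType) (n : nat) (f : nat -> R) :
  \sum_(i < n.+2) (-1) ^+ i * 'C(n.+1, i)%:R * f i =
  \sum_(i < n.+1) (-1) ^+ i * 'C(n, i)%:R * (f i - f i.+1).
Proof.
rewrite big_ord_recl /= bin0 expr0.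
under eq_bigr => i _ do rewrite /bump /= add1n binS natrD mulrDr mulrDl.
rewrite big_split /= addrA.
have -> : 1 * 1 * f 0%N +
    \sum_(i < n.+1) (-1) ^+ i.+1 * 'C(n, i.+1)%:R * f i.+1 =
    \sum_(i < n.+1) (-1) ^+ i * 'C(n, i)%:R * f i.
  transitivity (\sum_(i < n.+2) (-1) ^+ i * 'C(n, i)%:R * f i).
    by rewrite [RHS]big_ord_recl /= bin0 expr0.
  by rewrite big_ord_recr /= bin_small // mulr0 mul0r addr0.
rewrite -big_split; apply: eq_bigr => i _ /=.
by rewrite exprS mulrBr mulN1r !mulNr.
Qed.

(** A difference lowers the degree of a polynomial, so n differences kill
    every polynomial of degree below n. *)
Lemma alt_binomial_pow0 (R : comNzRingType) (n l : nat) (c : R) : (l < n)%N ->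
  \sum_(i < n.+1) (-1) ^+ i * 'C(n, i)%:R * (c + i%:R) ^+ l = 0.
Proof.
elim: n l c => [//|n IH] l c ln.
rewrite (@alt_binomial_sumS _ _ (fun i => (c + i%:R) ^+ l)).
have E i : (c + i%:R) ^+ l - (c + i.+1%:R) ^+ l =
    \sum_(b < l) - 'C(l, b)%:R * (c + i%:R) ^+ b.
  rewrite -natr1 addrA [_ + 1]addrC [X in _ - X]exprDn big_ord_recr /=.
  rewrite subnn expr0 binn mul1r mulr1n opprD addrCA subrr addr0 -sumrN.
  apply: eq_bigr => b _.
  by rewrite expr1n mul1r mulNr mulr_natl.
under eq_bigr => i _ do rewrite E mulr_sumr.
rewrite exchange_big big1 //= => b _.
under eq_bigr => i _ do rewrite mulrCA.
by rewrite -mulr_sumr IH ?mulr0 // (leq_trans (ltn_ord b)).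
Qed.

(** * Monotone additive functions *)

(** With 2^a <= k^n < 2^(a+1), both n (H k) (ln 2) and n (H 2) (ln k) lie
    between a (H 2) (ln 2) and (a + 1) (H 2) (ln 2); let n tend to infinity
    in their difference divided by n. *)
Lemma monotone_additive_ln (R : realType) (H : nat -> R) :
  (forall a b, (0 < a)%N -> (0 < b)%N -> H (a * b)%N = H a + H b) ->
  (forall a b, (0 < a)%N -> (a <= b)%N -> H a <= H b) ->
  forall k, (0 < k)%N -> H k = H 2%N / ln 2 * ln k%:R.
Proof.
move=> HM Hle k k0.
have l2 : (0 : R) < ln 2 by rewrite ln_gt0 // ltr1n.
have H1 : H 1%N = 0.
  by have := HM 1%N 1%N isT isT; rewrite muln1 => /eqP; rewrite -subr_eq subrr => /eqP.
have HX a n : (0 < a)%N -> H (a ^ n)%N = n%:R * H a.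
  move=> a0; elim: n => [|n IH]; first by rewrite expn0 H1 mul0r.
  by rewrite expnS HM ?expn_gt0 ?a0 // IH -natr1 mulrDl mul1r addrC.
have H20 : 0 <= H 2%N by rewrite -H1 Hle.
have lX a n : (0 < a)%N -> ln ((a ^ n)%:R : R) = n%:R * ln a%:R.
  by move=> a0; rewrite natrX lnXn ?ltr0n // mulr_natl.
have lle a b : (0 < a)%N -> (a <= b)%N -> ln (a%:R : R) <= ln b%:R.
  move=> a0 ab; rewrite ler_ln ?posrE ?ltr0n ?ler_nat //; exact: leq_trans ab.
pose D := H k * ln 2 - H 2%N * ln k%:R.
have bound (n : nat) : n%:R * `|D| <= H 2%N * ln 2.
  have kn0 : (0 < k ^ n)%N by rewrite expn_gt0 k0.
  have /= /andP[] := trunc_log_bounds (isT : (1 < 2)%N) kn0.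
  set a := trunc_log _ _ => la lb.
  have p0 b : (0 < 2 ^ b)%N by rewrite expn_gt0.
  have h1 := Hle _ _ (p0 _) la; have h2 := Hle _ _ kn0 (ltnW lb).
  have g1 := lle _ _ (p0 _) la; have g2 := lle _ _ kn0 (ltnW lb).
  move: h1 h2 g1 g2; rewrite !HX // !lX // -natr1 => h1 h2 g1 g2.
  rewrite -[n%:R]ger0_norm ?ler0n // -normrM ler_norml /D mulrBr.
  have := ler_wpM2r (ltW l2) h1; have := ler_wpM2r (ltW l2) h2.
  have := ler_wpM2l H20 g1; have := ler_wpM2l H20 g2.
  set A := a%:R; set B := n%:R; set X := H k; set Y := H 2%N; set L := ln 2; set M := ln k%:R.
  move=> *; apply/andP; split; lra.
have D0 : D = 0.
  apply/eqP/negPn/negP => Dn; have Dp : 0 < `|D| by rewrite normr_gt0.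
  have := bound (Num.truncn (H 2%N * ln 2 / `|D|)).+1.
  have := truncnS_gt (H 2%N * ln 2 / `|D|).
  by rewrite ltr_pdivrMr // => h1 h2; have := lt_le_trans h1 h2; rewrite ltxx.
move/eqP: D0; rewrite subr_eq0 => /eqP D0.
by rewrite mulrAC -D0 mulfK // gt_eqF.
Qed.

(** * Zeros of exponential sums *)

Definition expsum (R : realType) (n : nat) (c lam : nat -> R) (t : R) : R :=
  \sum_(i < n) c i * expR (lam i * t).

Lemma is_derive_expsum (R : realType) (n : nat) (c lam : nat -> R) (t : R) :
  is_derive t 1 (expsum n c lam) (expsum n (fun i => lam i * c i) lam t).
Proof.
have -> : expsum n c lam =
    \sum_(i < n) (fun t => c i * expR (lam i * t)).
  by apply/funext => y; rewrite fct_sumE.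
apply: is_derive_sum => i.
apply: is_derive_eq; rewrite /GRing.scale /=; ring.
Qed.

Lemma expsum_shift (R : realType) (n : nat) (c lam : nat -> R) (mu t : R) :
  expsum n c (fun i => lam i - mu) t = expR (- mu * t) * expsum n c lam t.
Proof.
rewrite /expsum mulr_sumr; apply: eq_bigr => i _.
by rewrite mulrCA mulrBl expRD mulNr [X in _ * X]mulrC.
Qed.

Lemma expsum_rolle (R : realType) (n : nat) (c lam : nat -> R) (a b : R) :
  a < b -> expsum n c lam a = 0 -> expsum n c lam b = 0 ->
  exists2 x, a < x < b & expsum n (fun i => lam i * c i) lam x = 0.
Proof.
move=> ab fa fb.
have [|||x] := @Rolle _ (expsum n c lam) a b ab.
- by move=> x _; apply: ex_derive; exact: is_derive_expsum.
- apply: derivable_within_continuous => x _.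
  by apply: ex_derive; exact: is_derive_expsum.
- by rewrite fa fb.
move=> xab dx; exists x; first by move: xab; rewrite in_itv.
have := @derive_val _ _ _ _ _ _ _ (is_derive_expsum n c lam x).
by rewrite (@derive_val _ _ _ _ _ _ _ dx).
Qed.

Lemma expsum_recr (R : realType) (n : nat) (c lam : nat -> R) (t : R) :
  expsum n.+1 c lam t = expsum n c lam t + c n * expR (lam n * t).
Proof. by rewrite /expsum big_ord_recr. Qed.

Definition insert_at (T : Type) (j : nat) (p : T) (x : nat -> T) (i : nat) : T :=
  if (i < j)%N then x i else if i == j then p else x i.-1.

Lemma insert_at_incr (R : realType) (n j : nat) (p : R) (x : nat -> R) :
  (forall i, (i.+1 < n)%N -> x i < x i.+1) -> (j <= n)%N ->
  ((0 < j)%N -> x j.-1 < p) -> ((j < n)%N -> p < x j) ->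
  forall i, (i < n)%N -> insert_at j p x i < insert_at j p x i.+1.
Proof.
move=> xm jn xl xr i ltin; rewrite /insert_at.
case: (ltngtP i.+1 j) => [ij|ij|ij].
- by apply: xm; lia.
- case: (eqVneq i j) => [->|nij] /=; first by apply: xr; lia.
  rewrite -{2}(@prednK i); last by lia.
  by apply: xm; lia.
by move: xl; rewrite -ij; apply.
Qed.

(** After division by its last exponential, the last term of the sum is a
    constant, which differentiation removes: Rolle's theorem turns k + 1 zeros
    of a sum of n + 1 exponentials into k zeros of a sum of n of them. *)
Lemma expsum_interlace (R : realType) (n k : nat) (c lam t : nat -> R) :
  (forall i, (i.+1 < k.+1)%N -> t i < t i.+1) ->
  (forall i, (i < k.+1)%N -> expsum n.+1 c lam (t i) = 0) ->
  let nu i := lam i - lam n in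
  {x : nat -> R & forall i, (i < k)%N ->
    t i < x i < t i.+1 /\ expsum n (fun i => nu i * c i) nu (x i) = 0}.
Proof.
move=> tm z nu.
apply: (@choice _ _ (fun i x => (i < k)%N ->
  t i < x < t i.+1 /\ expsum n (fun i => nu i * c i) nu x = 0)) => i.
case: (ltnP i k) => [ik|_]; last by exists 0.
have z' l : (l < k.+1)%N -> expsum n.+1 c nu (t l) = 0.
  by move=> ?; rewrite expsum_shift z ?mulr0.
have [x tx dx] := expsum_rolle (tm i ik) (z' i (leqW ik)) (z' i.+1 ik).
exists x => _; split=> //.
by move: dx; rewrite expsum_recr /nu subrr !mul0r addr0.
Qed.

(** Descartes' rule in its crude form: a nontrivial sum of n exponentials has
    fewer than n real zeros. *)
Lemma expsum_eq0 (R : realType) (n : nat) (c lam t : nat -> R) :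
  {in gtn n &, injective lam} ->
  (forall i, (i.+1 < n)%N -> t i < t i.+1) ->
  (forall i, (i < n)%N -> expsum n c lam (t i) = 0) ->
  forall i, (i < n)%N -> c i = 0.
Proof.
elim: n c lam t => [//|n IH] c lam t lami tm z.
pose nu i := lam i - lam n.
have nu0 i : (i < n)%N -> nu i != 0.
  move=> ltin; rewrite subr_eq0; apply/eqP => E.
  have iE : i = n by apply: (lami _ _ _ _ E); rewrite inE ?leqnn // leqW.
  by move: ltin; rewrite iE ltnn.
have [x xP] := expsum_interlace tm z.
have c0 i : (i < n)%N -> c i = 0.
  move=> ltin; have /eqP : nu i * c i = 0.
    apply: (IH (fun i => nu i * c i) nu x) => // [k l|k kn|k kn].
    - by rewrite !inE => kn ln /addIr; apply: lami; rewrite inE leqW.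
    - have [/andP[_ h] _] := xP _ (ltnW kn); have [/andP[h' _] _] := xP _ kn.
      exact: lt_trans h h'.
    - by case: (xP _ kn).
  by rewrite mulf_eq0 (negbTE (nu0 _ ltin)) => /eqP.
move=> i; rewrite ltnS leq_eqVlt => /orP[/eqP ->|]; last exact: c0.
have := z 0%N isT; rewrite expsum_recr /expsum big1 => [|k _]; last by rewrite c0 ?mul0r.
rewrite add0r => /eqP; rewrite mulf_eq0 => /orP[/eqP //|].
by rewrite gt_eqF ?expR_gt0.
Qed.

(** The same count with one double zero. It stays a zero of the derivative,
    in addition to the zeros that Rolle's theorem gives between consecutive
    zeros, so the derivative, with n exponentials, still has n zeros. *)
Lemma expsum_double_eq0 (R : realType) (n j : nat) (c lam t : nat -> R) :
  {in gtn n.+1 &, injective lam} ->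
  (forall i, (i.+1 < n)%N -> t i < t i.+1) ->
  (forall i, (i < n)%N -> expsum n.+1 c lam (t i) = 0) ->
  (j < n)%N -> expsum n.+1 (fun i => lam i * c i) lam (t j) = 0 ->
  forall i, (i < n)%N -> c i = 0.
Proof.
case: n => [//|n] lami tm z jn dz.
pose nu i := lam i - lam n.+1.
have nu0 i : (i < n.+1)%N -> nu i != 0.
  move=> ltin; rewrite subr_eq0; apply/eqP => E.
  have iE : i = n.+1 by apply: (lami _ _ _ _ E); rewrite inE ?leqnn // leqW.
  by move: ltin; rewrite iE ltnn.
have [x xP] := expsum_interlace tm z.
move=> i ltin; have /eqP : nu i * c i = 0.
  apply: (@expsum_eq0 _ n.+1 (fun i => nu i * c i) nu (insert_at j (t j) x)) => // [k l|k kn|k kn].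
  - by rewrite !inE => kn ln /addIr; apply: lami; rewrite inE leqW.
  - apply: (@insert_at_incr _ n) => // [l ln|j0|jn'].
    + have [/andP[_ h] _] := xP _ (ltnW ln); have [/andP[h' _] _] := xP _ ln.
      exact: lt_trans h h'.
    + by case: (xP j.-1) => [|/andP[_]]; rewrite prednK.
    + by case: (xP j) => [|/andP[]].
  - rewrite /insert_at; case: (ltngtP k j) => [kj|kj|_].
    + by case: (xP k) => //; apply: leq_trans kj _.
    + by case: (xP k.-1) => //; lia.
    + have -> : expsum n.+1 (fun i => nu i * c i) nu (t j) =
        expsum n.+2 (fun i => nu i * c i) nu (t j).
        by rewrite [RHS]expsum_recr /nu subrr !mul0r addr0.
      rewrite expsum_shift.
      have -> : expsum n.+2 (fun i => nu i * c i) lam (t j) =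
          expsum n.+2 (fun i => lam i * c i) lam (t j) - lam n.+1 * expsum n.+2 c lam (t j).
        rewrite /expsum mulr_sumr -sumrB; apply: eq_bigr => l _.
        by rewrite /nu; ring.
      by rewrite dz z // mulr0 subrr mulr0.
by rewrite mulf_eq0 (negbTE (nu0 _ ltin)) => /eqP.
Qed.

(** * The coefficients of the symmetric difference *)

Lemma big_ord_fold (V : nmodType) (m : nat) (F : nat -> V) :
  \sum_(i < (2 * m).+1) F i =
  F m + \sum_(1 <= k < m.+1) (F (m + k)%N + F (m - k)%N).
Proof.
rewrite -(big_mkord xpredT F) (big_cat_nat _ (n := m)) //=; last by lia.
rewrite (big_ltn (m := m)); last by lia.
rewrite addrCA big_split /= [X in _ + X]addrC; congr (_ + (_ + _)).
  rewrite -[m.+1]add1n big_addn big_nat_rev /=.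
  have -> : ((2 * m).+1 - m = m.+1)%N by lia.
  rewrite big_nat_rev /=; apply: eq_big_nat => k /andP[k1 km].
  by congr F; lia.
rewrite big_add1 /= big_nat_rev /=; apply: eq_big_nat => k /andP[k1 km].
by congr F; lia.
Qed.

(** The coefficient of z^k and of z^-k in (2 - z - z^-1)^m. *)
Definition symm_coef (R : nzRingType) (m k : nat) : R :=
  (-1) ^+ k * 'C(2 * m, m - k)%:R.

Lemma delta_symm (R : realType) (N m : nat) (u : 'rV[R]_N -> R) (x y : 'rV[R]_N) :
  delta m u x y = 'C(2 * m, m)%:R * u x +
    \sum_(1 <= k < m.+1) symm_coef R m k * (u (x + k%:R *: y) + u (x - k%:R *: y)).
Proof.
rewrite /delta (@big_ord_fold _ m (fun j => let k := j%:Z - m%:Z in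
    (-1) ^ k * 'C(2 * m, `|m%:Z - k|)%:R * u (x + k%:~R *: y))) /=.
rewrite subrr subr0 expr0z mul1r absz_nat scale0r addr0; congr +%R.
apply: eq_big_nat => k /andP[k1 km]; rewrite mulrDr; congr +%R.
- have -> : (m + k)%:Z - m%:Z = k%:Z by lia.
  by have -> : `|m%:Z - k%:Z|%N = (m - k)%N by lia.
- have -> : (m - k)%:Z - m%:Z = - k%:Z by lia.
  rewrite opprK -PoszD absz_nat mulrNz scaleNr; congr (_ * _).
  rewrite /symm_coef -exprz_inv invrN1 -[in RHS]bin_sub; last by lia.
  by have -> : (2 * m - (m - k) = m + k)%N by lia.
Qed.

(** The polynomial (2 - z - z^-1)^m has a zero of order 2m at z = 1. For
    j = 0 the coefficient with index 0 contributes; in higher even degree the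
    factor 0^(2j) suppresses it. *)
Lemma symm_coef_moment (R : comNzRingType) (m j : nat) : (j < m)%N ->
  'C(2 * m, m)%:R *+ (j == 0)%N +
    (\sum_(1 <= k < m.+1) symm_coef R m k * k%:R ^+ (2 * j)) *+ 2 = 0.
Proof.
move=> jm; have AA : (-1) ^+ m * (-1) ^+ m = 1 :> R.
  by rewrite -exprD addnn -mul2n exprM sqrrN expr1n expr1n.
have := @alt_binomial_pow0 R (2 * m) (2 * j) (- m%:R).
rewrite (@big_ord_fold _ m (fun i => (-1) ^+ i * 'C(2 * m, i)%:R * (- m%:R + i%:R) ^+ (2 * j))).
move=> /(_ ltac:(lia)) /(congr1 ( *%R ((-1) ^+ m))).
rewrite mulr0 => E; rewrite -[RHS]E mulrDr; congr +%R.
  rewrite addNr !mulrA AA mul1r.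
  by case: j {jm E} => [|j]; rewrite ?muln0 ?expr0 ?mulr1 //= expr0n mulr0.
rewrite -mulr_natl !mulr_sumr; apply: eq_big_nat => k /andP[k1 km].
have -> : - m%:R + (m + k)%:R = k%:R :> R by rewrite natrD addKr.
have -> : - m%:R + (m - k)%:R = - k%:R :> R by rewrite natrB // addrA addNr add0r.
rewrite [(- k%:R) ^+ _]exprM sqrrN -exprM.
rewrite -[in 'C(2 * m, m + k)]bin_sub; last by lia.
have -> : (2 * m - (m + k) = m - k)%N by lia.
have -> : (-1) ^+ (m + k) = (-1) ^+ m * (-1) ^+ k :> R by rewrite exprD.
have -> : (-1) ^+ (m - k) = (-1) ^+ m * (-1) ^+ k :> R.
  by rewrite -exprD -signr_odd oddB // -oddD signr_odd.
rewrite /symm_coef; move: AA; set A := (-1) ^+ m => AA; ring: AA.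
Qed.

Section nonvanishing.
Variables (R : realType).

Let c m i : R := symm_coef R m i.+1.
Let lam i : R := ln i.+1%:R.

Lemma sum_powR_expsum (b : nat -> R) (m : nat) (t : R) :
  \sum_(1 <= k < m.+1) b k * k%:R `^ t = expsum m (fun i => b i.+1) lam t.
Proof.
rewrite big_add1 /= big_mkord /expsum; apply: eq_bigr => i _.
by rewrite /powR pnatr_eq0 /= mulrC [t * _]mulrC [in RHS]mulrC.
Qed.

Lemma ln_nat_inj (m : nat) : {in gtn m &, injective lam}.
Proof.
move=> i j _ _ /ln_inj; rewrite !posrE !ltr0n => /(_ isT isT) /eqP.
by rewrite eqr_nat => /eqP[].
Qed.

Lemma symm_coef_expsum_even (m i : nat) : (i.+1 < m)%N ->
  expsum m (c m) lam (2 * i.+1%:R) = 0.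
Proof.
move=> im; rewrite -sum_powR_expsum.
have /eqP := @symm_coef_moment R _ _ im.
rewrite add0r mulrn_eq0 /= => /eqP E; rewrite -[RHS]E.
apply: eq_bigr => k _; congr (_ * _).
by rewrite -natrM powR_mulrn ?ler0n.
Qed.

Lemma symm_coef_neq0 (m k : nat) : (k <= m)%N -> symm_coef R m k != 0.
Proof.
move=> km; rewrite mulf_neq0 // ?signr_eq0 // pnatr_eq0 -lt0n bin_gt0; lia.
Qed.

(** As a function of the exponent, this sum of m exponentials vanishes at
    2, 4, ..., 2(m - 1), and 2s would be an m-th zero. *)
Lemma symm_coef_powR_neq0 (m : nat) (s : R) :
  0 < s < m%:R -> s \isn't a Num.nat ->
  \sum_(1 <= k < m.+1) symm_coef R m k * k%:R `^ (2 * s) != 0.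
Proof.
case: m => [|m]; first by move=> /andP[? ?]; lra.
move=> /andP[s0 sm] sN; apply/eqP; rewrite sum_powR_expsum -/(c m.+1) => z.
have ts := truncn_itv (ltW s0); set j := Num.truncn s in ts.
have jm : (j <= m)%N.
  rewrite -ltnS -(ltr_nat R); apply: le_lt_trans sm; by case/andP: ts.
have js : j%:R < s.
  case/andP: ts; rewrite le_eqVlt => /orP[/eqP js|//].
  by rewrite -js natr_nat in sN.
suff /eqP : symm_coef R m.+1 m.+1 = 0 by rewrite (negbTE (symm_coef_neq0 _)).
apply: (@expsum_eq0 R m.+1 (c m.+1) lam
  (insert_at j (2 * s) (fun i => 2 * i.+1%:R)) (@ln_nat_inj _)) (ltnSn m).
- move=> i; rewrite ltnS; apply: insert_at_incr => // [k _|j0|_].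
  + by rewrite ltr_pM2l // ltr_nat.
  + by rewrite ltr_pM2l // prednK.
  + by rewrite ltr_pM2l //; case/andP: ts.
- move=> i im; rewrite /insert_at; case: ltngtP => [ij|ji|//].
    by apply: symm_coef_expsum_even; lia.
  by apply: symm_coef_expsum_even; lia.
Qed.

(** The sum is the derivative, with respect to the exponent, of a sum of m
    exponentials at one of its m - 1 zeros 2, 4, ..., 2(m - 1), which
    therefore cannot be double. *)
Lemma symm_coef_ln_neq0 (m l : nat) : (0 < l < m)%N ->
  \sum_(1 <= k < m.+1) symm_coef R m k * k%:R `^ (2 * l%:R) * ln k%:R != 0.
Proof.
case: m => [|m] /andP[l0 lm] //; apply/eqP => z.
suff /eqP : symm_coef R m.+1 1 = 0 by rewrite (negbTE (symm_coef_neq0 _)).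
apply: (@expsum_double_eq0 R m l.-1 (c m.+1) lam (fun i => 2 * i.+1%:R)
  (@ln_nat_inj _)) (_ : 0 < m)%N; last by lia.
- by move=> k _; rewrite ltr_pM2l // ltr_nat.
- by move=> i im; apply: symm_coef_expsum_even.
- by lia.
rewrite prednK // -[RHS]z.
rewrite -(sum_powR_expsum (fun k => ln k%:R * symm_coef R m.+1 k)).
by apply: eq_bigr => k _; ring.
Qed.

End nonvanishing.

(** * The Euclidean norm *)

Section enorm_theory.
Variables (R : realType) (N : nat).
Implicit Types x y z : 'rV[R]_N.

Let sqr_ge0_sum x : 0 <= \sum_(i < N) x ord0 i ^+ 2.
Proof. by apply: sumr_ge0 => i _; exact: sqr_ge0. Qed.

Lemma enorm_ge0 x : 0 <= enorm x.
Proof. exact: sqrtr_ge0. Qed.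

Lemma le_coord_enorm x i : `|x ord0 i| <= enorm x.
Proof.
rewrite -sqrtr_sqr ler_wsqrtr // (bigD1 i) //= lerDl.
by apply: sumr_ge0 => j _; exact: sqr_ge0.
Qed.

Lemma enormZ (t : R) x : enorm (t *: x) = `|t| * enorm x.
Proof.
rewrite /enorm -sqrtr_sqr -sqrtrM ?sqr_ge0 // mulr_sumr; congr Num.sqrt.
by apply: eq_bigr => i _; rewrite mxE exprMn.
Qed.

Lemma enorm0 : enorm (0 : 'rV[R]_N) = 0.
Proof. by rewrite -(scale0r 0) enormZ normr0 mul0r. Qed.

Lemma enormN x : enorm (- x) = enorm x.
Proof. by rewrite -scaleN1r enormZ normrN1 mul1r. Qed.

(** The factor 2 spares the Cauchy-Schwarz inequality; only the order of
    magnitude is used. *)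
Lemma enormD_le x y : enorm (x + y) <= 2 * (enorm x + enorm y).
Proof.
have sq z : enorm z ^+ 2 = \sum_(i < N) z ord0 i ^+ 2 by rewrite sqr_sqrtr.
rewrite -(@ler_sqr _ (enorm (x + y))) ?nnegrE ?mulr_ge0 ?addr_ge0 ?enorm_ge0 //.
apply: (@le_trans _ _ (2 * enorm x ^+ 2 + 2 * enorm y ^+ 2)).
  rewrite !sq !mulr_sumr -big_split /=; apply: ler_sum => i _; rewrite mxE.
  rewrite -subr_ge0 [leRHS](_ : _ = (x ord0 i - y ord0 i) ^+ 2) ?sqr_ge0 //.
  ring.
have := enorm_ge0 x; have := enorm_ge0 y; nra.
Qed.

Lemma norm_le_enorm x : `|x| <= enorm x.
Proof.
case: (eqVneq (mx_norm x) 0) => [x0|/mx_norm_neq0 [[i j] /= xE]].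
  by rewrite [`|x|]x0 enorm_ge0.
by rewrite [`|x|]xE (ord1 i) le_coord_enorm.
Qed.

(** Neighbourhoods are those of the sup norm, which is at most the Euclidean
    norm. *)
Lemma near_enorm x (P : set 'rV[R]_N) : (\forall y \near x, P y) ->
  exists2 r, 0 < r & forall z, enorm z < r -> P (x + z).
Proof.
move=> /nbhs_ballP[r /= r0 rP]; exists r => // z zr; apply: rP.
rewrite mx_norm_ball /ball_ /= opprD addrA subrr add0r normrN.
exact: le_lt_trans (norm_le_enorm z) zr.
Qed.
End enorm_theory.

(** * Directional derivatives from partial derivatives *)

Section directional.
Variables (R : realType) (N : nat).
Implicit Types (f : 'rV[R]_N -> R) (x y z : 'rV[R]_N).

(** Both difference quotients are the same function of the increment. *)
Lemma is_derive_lineP f x z (t df : R) :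
  is_derive t 1 (fun t => f (x + t *: z)) df <-> is_derive (x + t *: z) z f df.
Proof.
have E : (fun h : R => h^-1 *: (((fun t => f (x + t *: z)) \o shift t) (h *: 1) - f (x + t *: z))) =
    (fun h : R => h^-1 *: ((f \o shift (x + t *: z)) (h *: z) - f (x + t *: z))).
  apply/funext => h /=; congr (_ *: (f _ - _)).
  by rewrite [h *: 1]mulr1 scalerDl addrCA.
by split=> -[fd fE]; apply: DeriveDef; move: fd fE; rewrite /derivable /derive E.
Qed.

Lemma mean_value_line f (df : R -> R) x z :
  (forall t, 0 <= t <= 1 -> is_derive (x + t *: z) z f (df t)) ->
  exists2 t, 0 < t < 1 & f (x + z) - f x = df t.
Proof.
move=> fd; have [||t] := @MVT R (fun t => f (x + t *: z)) df 0 1 ltr01.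
- move=> t; rewrite in_itv /= => /andP[t0 t1]; apply/is_derive_lineP.
  by apply: fd; rewrite !ltW.
- apply: derivable_within_continuous => t; rewrite in_itv => /= t01.
  by apply: ex_derive; apply/is_derive_lineP; apply: fd.
rewrite in_itv /= => t01; rewrite scale1r scale0r addr0 subr0 mulr1 => E.
by exists t.
Qed.

Lemma is_deriveZ_dir f x z (a : R) : derivable f x z ->
  is_derive x (a *: z) f (a * 'D_z f x).
Proof.
move=> fd; have := is_derive_lineP f x (a *: z) 0 (a * 'D_z f x).
rewrite scale0r addr0 => -[+ _]; apply.
have -> : (fun t => f (x + t *: (a *: z))) = (fun s => f (x + s *: z)) \o *%R a.
  by apply/funext => t /=; rewrite scalerA mulrC.
rewrite mulrC; apply: is_derive1_comp; last first.
  by apply: is_derive_eq; rewrite /GRing.scale /= mulr1.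
apply/is_derive_lineP; rewrite mulr0 scale0r addr0.
exact: DeriveDef.
Qed.

Let e i : 'rV[R]_N := delta_mx ord0 i.

(** The vertices of the path from 0 to z that moves along one coordinate axis
    after the other. *)
Definition trunc_row (n : nat) z : 'rV[R]_N := \row_i (if (i < n)%N then z ord0 i else 0).

Lemma trunc_row0 z : trunc_row 0 z = 0.
Proof. by apply/rowP => i; rewrite !mxE. Qed.

Lemma trunc_row_full z : trunc_row N z = z.
Proof. by apply/rowP => i; rewrite !mxE ltn_ord. Qed.

Lemma trunc_rowS (i : 'I_N) z : trunc_row i.+1 z = trunc_row i z + z ord0 i *: e i.
Proof.
apply/rowP => j; rewrite !mxE ltnS leq_eqVlt /=.
case: (eqVneq (j : nat) i) => [/val_inj ->|ji] /=.
  by rewrite ltnn eqxx mulr1 add0r.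
by rewrite (_ : (j == i) = false) ?mulr0 ?addr0 //; apply/negbTE.
Qed.

Lemma enorm_trunc_segment (i : 'I_N) z (t : R) : 0 <= t <= 1 ->
  enorm (trunc_row i z + t *: (z ord0 i *: e i)) <= enorm z.
Proof.
move=> /andP[t0 t1]; rewrite ler_wsqrtr //; apply: ler_sum => j _.
rewrite !mxE /=; case: (eqVneq j i) => [->|ji].
  rewrite ltnn add0r mulr1 exprMn ler_piMl ?sqr_ge0 //; nra.
by rewrite !mulr0 addr0; case: ifP => // _; rewrite expr0n sqr_ge0.
Qed.

(** The increment of f from y to y + h z is split along the path through the
    truncations of h z; on each segment the mean value theorem gives a partial
    derivative at a point near y, which by continuity is close to its value
    at y. *)
Lemma is_derive_partials f y z :
  (\forall w \near y, forall i, derivable f w (e i)) ->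
  (forall i, {for y, continuous ('D_(e i) f)}) ->
  is_derive y z f (\sum_(i < N) z ord0 i * 'D_(e i) f y).
Proof.
move=> fd fc; set L := \sum_(i < N) _.
have cv : h^-1 *: ((f \o shift y) (h *: z) - f y) @[h --> 0^'] --> L.
  apply/cvgrPdist_le => eps eps0.
  (* The summand 1 keeps M positive for z = 0. *)
  pose M := 1 + \sum_(i < N) `|z ord0 i|.
  have M0 : 0 < M by rewrite ltr_pwDl // sumr_ge0.
  have : \forall w \near y, forall i, derivable f w (e i) /\
      `|'D_(e i) f y - 'D_(e i) f w| <= eps / M.
    apply: (@filter_forall _ _ (fun i w => derivable f w (e i) /\
      `|'D_(e i) f y - 'D_(e i) f w| <= eps / M) (nbhs y)) => i.
    have /cvgrPdist_le H := fc i.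
    by apply: filterS2 fd (H _ (divr_gt0 eps0 M0)) => w fdw hw; split.
  move=> /near_enorm[r r0 rP].
  near=> h.
  have h0 : h != 0 by near: h; exact: nbhs_dnbhs_neq.
  have hr : enorm (h *: z) < r.
    rewrite enormZ; apply: le_lt_trans (_ : `|h| * (enorm z + 1) < _).
      by rewrite ler_wpM2l // lerDl.
    have z1 : 0 < enorm z + 1 by rewrite ltr_wpDl ?enorm_ge0.
    rewrite -ltr_pdivlMr //; near: h; apply: dnbhs0_lt.
    by rewrite divr_gt0 // ltr_wpDl ?enorm_ge0.
  have step (i : 'I_N) :
    `|f (y + trunc_row i.+1 (h *: z)) - f (y + trunc_row i (h *: z)) - h * z ord0 i * 'D_(e i) f y|
       <= `|h| * `|z ord0 i| * (eps / M).
    have dv t : 0 <= t <= 1 -> is_derive (y + trunc_row i (h *: z) + t *: ((h * z ord0 i) *: e i))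
       ((h * z ord0 i) *: e i) f ((h * z ord0 i) *
       'D_(e i) f (y + (trunc_row i (h *: z) + t *: ((h * z ord0 i) *: e i)))).
      move=> t01; rewrite -addrA; apply: is_deriveZ_dir.
      have [] := rP (trunc_row i (h *: z) + t *: ((h * z ord0 i) *: e i)) _ i => //.
      apply: le_lt_trans hr.
      have := @enorm_trunc_segment i (h *: z) t t01; by rewrite mxE.
    have [t t01] := mean_value_line dv.
    rewrite -addrA.
    have -> : trunc_row i (h *: z) + (h * z ord0 i) *: e i = trunc_row i.+1 (h *: z).
      by rewrite trunc_rowS mxE.
    move=> ->; rewrite -mulrBr normrM normrM ler_wpM2l // distrC.
    have [] := rP (trunc_row i (h *: z) + t *: ((h * z ord0 i) *: e i)) _ i => //.
    apply: le_lt_trans hr.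
    have := @enorm_trunc_segment i (h *: z) t; rewrite mxE; apply.
    by case/andP: t01 => *; rewrite !ltW.
  have tel : f (h *: z + y) - f y = \sum_(i < N)
      (f (y + trunc_row i.+1 (h *: z)) - f (y + trunc_row i (h *: z))).
    rewrite -(big_mkord xpredT (fun i => f (y + trunc_row i.+1 (h *: z)) - f (y + trunc_row i (h *: z)))).
    by rewrite (telescope_sumr (fun i => f (y + trunc_row i (h *: z)))) // trunc_row_full trunc_row0 addr0 [y + _]addrC.
  rewrite /= tel; pose D (i : 'I_N) := f (y + trunc_row i.+1 (h *: z)) - f (y + trunc_row i (h *: z)).
  have -> : L - h^-1 *: (\sum_(i < N) D i) =
      - (h^-1 * \sum_(i < N) (D i - h * z ord0 i * 'D_(e i) f y)).
    rewrite [X in _ = - (_ * X)](_ : _ = \sum_(i < N) D i - h * L).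
      by rewrite mulrBr mulKf // opprB.
    rewrite sumrB mulr_sumr; congr (_ - _).
    by apply: eq_bigr => i _; rewrite mulrA.
  rewrite normrN normrM normfV ler_pdivrMl ?normr_gt0 //.
  apply: le_trans (ler_norm_sum _ _ _) _.
  apply: le_trans (ler_sum _ (fun i _ => step i)) _.
  under eq_bigr do rewrite -mulrA.
  rewrite -mulr_sumr ler_wpM2l // -mulr_suml mulrCA ger_pMr // ler_pdivrMr // mul1r /M.
  by rewrite lerDr.
apply: DeriveDef; first by apply/cvg_ex; exists L.
exact: cvg_lim cv.
Unshelve. all: by end_near.
Qed.
End directional.

(** * Homogeneous polynomials and Taylor expansion *)

Section taylor.
Variables (R : realType) (N : nat).
Implicit Types (f p : 'rV[R]_N -> R) (x y z : 'rV[R]_N).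

Let e i : 'rV[R]_N := delta_mx ord0 i.

(** Homogeneous polynomials of degree l, presented by iterated division by the
    coordinates: in this form the induction in taylor produces them from the
    expansions of the partial derivatives, without multi-indices and without
    symmetry of higher derivatives. *)
Fixpoint hpoly (l : nat) p : Prop :=
  if l is l'.+1 then
    exists2 q : 'I_N -> 'rV[R]_N -> R, (forall i, hpoly l' (q i)) &
      forall z, p z = \sum_(i < N) z ord0 i * q i z
  else exists c, forall z, p z = c.

Lemma hpolyZ (l : nat) (a : R) p : hpoly l p -> hpoly l (fun z => a * p z).
Proof.
elim: l p => [|l IH] p /=.
  by move=> [c pc]; exists (a * c) => z; rewrite pc.
move=> [q ql pq]; exists (fun i z => a * q i z) => [i|z]; first exact/IH/ql.
by rewrite pq mulr_sumr; apply: eq_bigr => i _; rewrite mulrCA.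
Qed.

Lemma hpoly_homogeneous (l : nat) p (t : R) z : hpoly l p ->
  p (t *: z) = t ^+ l * p z.
Proof.
elim: l p => [|l IH] p /=.
  by move=> [c pc]; rewrite !pc expr0 mul1r.
move=> [q ql pq]; rewrite !pq mulr_sumr; apply: eq_bigr => i _.
by rewrite mxE IH // exprS; ring.
Qed.

Lemma hpoly_bound (l : nat) p : hpoly l p ->
  exists2 C, 0 <= C & forall z, `|p z| <= C * enorm z ^+ l.
Proof.
elim: l p => [|l IH] p /=.
  by move=> [c pc]; exists `|c| => // z; rewrite pc expr0 mulr1.
move=> [q ql pq].
have [C CP] := choice (fun i => let: ex_intro2 C C0 CP := IH _ (ql i) in
   ex_intro (fun C => 0 <= C /\ forall z, `|q i z| <= C * enorm z ^+ l) C (conj C0 CP)).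
exists (\sum_i C i) => [|z]; first by apply: sumr_ge0 => i _; case: (CP i).
rewrite pq (le_trans (ler_norm_sum _ _ _)) // mulr_suml; apply: ler_sum => i _.
have [C0 Cz] := CP i.
rewrite normrM exprS mulrCA; apply: ler_pM => //; exact: le_coord_enorm.
Qed.

Lemma iter_partial_rcons I i f : iter_partial (rcons I i) f = iter_partial I ('D_(e i) f).
Proof. by rewrite /iter_partial foldr_rcons. Qed.

Lemma Ck_partial (k : nat) (U : set 'rV[R]_N) f i :
  Ck k.+1 U f -> Ck k U ('D_(e i) f).
Proof.
move=> [fc fd]; split => I Ik; rewrite -iter_partial_rcons.
  by apply: fc; rewrite size_rcons.
by apply: fd; rewrite size_rcons.
Qed.

Lemma is_derive_monomial (c t : R) (l : nat) :
  is_derive t 1 (fun t : R => t ^+ l * c) (l%:R * t ^+ l.-1 * c).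
Proof.
have -> : (fun t : R => t ^+ l * c) = c \*: ((id : R -> R) ^+ l).
  by apply/funext => y /=; rewrite fctE mulrC.
apply: is_derive_eq; rewrite /GRing.scale /= mulr1; ring.
Qed.

(** By induction, each partial derivative D_i f has an expansion with terms
    q_(i,l). With p_(l+1) = (l+1)^-1 sum_i z_i q_(i,l), the function
    t |-> f (x + t z) - sum_l t^l p_l z vanishes at 0, and its derivative is
    sum_i z_i times the remainder of D_i f at t z, which gains one order. *)
Lemma taylor (U : set 'rV[R]_N) (k : nat) (tau : R) f x :
  open U -> U x -> 0 < tau -> Ck k U f ->
  (forall I : seq 'I_N, size I = k -> locally_hoelder tau U (iter_partial I f)) ->
  exists2 p : nat -> 'rV[R]_N -> R, (forall l, hpoly l (p l)) &
  exists C r, [/\ 0 <= C, 0 < r & forall z, enorm z < r ->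
    `|f (x + z) - \sum_(l < k.+1) p l z| <= C * enorm z `^ (k%:R + tau)].
Proof.
move=> Uo Ux tau0; elim: k f => [|k IH] f fCk fH.
  exists (fun l z => if l is 0%N then f x else 0).
    case=> [|l] /=; first by exists (f x).
    exists (fun _ _ => 0) => [i|z]; last by rewrite big1 // => i _; rewrite mulr0.
    by elim: l => [|l IH] /=; [exists 0|exists (fun _ _ => 0) => // z; rewrite big1 // => j _; rewrite mulr0].
  have [C CP] := fH [::] erefl x Ux.
  have /near_enorm[r r0 rP] : \forall y \near x, `|f y - f x| <= C * enorm (y - x) `^ tau.
    case: CP => -[A B] [/= Ax Bx] AB; apply: filterS Ax => y Ay.
    by apply: (AB (y, x)); split => //; apply: nbhs_singleton Bx.
  exists `|C|, r; split; [exact: normr_ge0|exact: r0|move=> z /rP; rewrite big_ord1 [x + z - x]addrAC subrr !add0r => h].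
  by apply: le_trans h _; rewrite ler_wpM2r ?powR_ge0 // ler_norm.
pose Q i (p : nat -> 'rV[R]_N -> R) := (forall l, hpoly l (p l)) /\
  exists C r, [/\ 0 <= C, 0 < r & forall z, enorm z < r ->
    `|'D_(e i) f (x + z) - \sum_(l < k.+1) p l z| <= C * enorm z `^ (k%:R + tau)].
have [p pP] : {p & forall i, Q i (p i)}.
  apply: choice => i.
  have [||p hp pP] := IH ('D_(e i) f); first exact: Ck_partial.
    by move=> I Ik; rewrite -iter_partial_rcons; apply: fH; rewrite size_rcons Ik.
  by exists p; split.
have [C CP] := choice (fun i => (pP i).2).
have [r rP] := choice CP.
have fd w : U w -> forall z, is_derive w z f (\sum_(i < N) z ord0 i * 'D_(e i) f w).
  move=> Uw z; apply: is_derive_partials => [|i].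
    apply: filterS (Uo w Uw) => y Uy i.
    by apply: (fCk.2 [::]).
  by apply: (fCk.1 [:: i]).
have /near_enorm[r0 r00 r0P] : \forall w \near x, U w by apply: Uo.
have [rho rho0 rhoP] : exists2 rho, 0 < rho & forall z, enorm z < rho -> U (x + z) /\ forall i, enorm z < r i.
  (* The default r0 of the minimum ensures that the ball lies in U. *)
  exists (\big[Num.min/r0]_i r i).
    by apply: lt_bigmin => // i _; case: (rP i).
  move=> z zr; split; first by apply: r0P; apply: lt_le_trans zr (bigmin_le_id _ _ _ _).
  by move=> i; apply: lt_le_trans zr (bigmin_le_cond _ _ _).
pose P l z := if l is l'.+1 then l'.+1%:R^-1 * \sum_i z ord0 i * p i l' z else f x.
exists P.
  case=> [|l]; first by exists (f x).
  by apply: hpolyZ; exists (fun i => p i l) => // i; apply: (pP i).1.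
exists (\sum_i C i), rho; split => // [|z zrho].
  by apply: sumr_ge0 => i _; case: (rP i).
pose psi (t : R) := f (x + t *: z) - \sum_(l < k.+2) t ^+ l * P l z.
pose dpsi (t : R) := \sum_i z ord0 i * ('D_(e i) f (x + t *: z) - \sum_(l < k.+1) p i l (t *: z)).
have seg t : 0 <= t <= 1 -> enorm (t *: z) <= enorm z.
  by move=> /andP[t0 t1]; rewrite enormZ ger0_norm // ler_piMl ?enorm_ge0.
have dpsiP (t : R) : 0 <= t <= 1 -> is_derive t 1 psi (dpsi t).
  move=> t01.
  have [Uxt _] : U (x + t *: z) /\ forall i, enorm (t *: z) < r i.
    by apply: rhoP; apply: le_lt_trans zrho; apply: seg.
  have d1 : is_derive t 1 (fun t => f (x + t *: z)) (\sum_(i < N) z ord0 i * 'D_(e i) f (x + t *: z)).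
    by apply/is_derive_lineP; apply: fd.
  have d2 : is_derive t 1 (\sum_(l < k.+2) (fun t => t ^+ l * P l z))
      (\sum_(l < k.+2) (l%:R * t ^+ l.-1 * P l z)).
    by apply: is_derive_sum => l; apply: is_derive_monomial.
  have E : psi = (fun t => f (x + t *: z)) - (\sum_(l < k.+2) (fun t => t ^+ l * P l z)).
    by apply/funext => s; rewrite /psi /= fct_sumE.
  rewrite E; apply: is_derive_eq; rewrite -/e.
  rewrite big_ord_recl mul0r mul0r add0r /dpsi.
  under [RHS]eq_bigr do rewrite mulrBr mulr_sumr.
  rewrite sumrB exchange_big; congr (_ - _); apply: eq_bigr => l _ /=.
  rewrite /bump /= add1n !add0n [l.+1%:R * _]mulrC mulrA mulfK ?pnatr_eq0 // mulr_sumr.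
  by apply: eq_bigr => i _; rewrite (hpoly_homogeneous _ _ ((pP i).1 l)) mulrCA.
have [||t] := @MVT R psi dpsi 0 1 ltr01.
- by move=> t; rewrite in_itv /= => /andP[t0 t1]; apply: dpsiP; rewrite !ltW.
- apply: derivable_within_continuous => t; rewrite in_itv /= => t01.
  by apply: ex_derive; apply: dpsiP.
rewrite in_itv subr0 mulr1 /= => /andP[t0 t1].
have -> : psi 0 = 0.
  rewrite /psi scale0r addr0 big_ord_recl expr0 mul1r big1 ?addr0 ?subrr // => l _.
  by rewrite expr0n mul0r.
have -> : psi 1 = f (x + z) - \sum_(l < k.+2) P l z.
  rewrite /psi scale1r; congr (_ - _); apply: eq_bigr => l _.
  by rewrite expr1n mul1r.
rewrite subr0 => ->.
rewrite /dpsi (le_trans (ler_norm_sum _ _ _)) // mulr_suml; apply: ler_sum => i _.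
have t01 : 0 <= t <= 1 by rewrite !ltW.
have [Uxt rt] : U (x + t *: z) /\ forall i, enorm (t *: z) < r i.
  by apply: rhoP; apply: le_lt_trans zrho; apply: seg.
have [C0 _ /(_ _ (rt i)) h] := rP i.
rewrite normrM.
have -> : enorm z `^ (k.+1%:R + tau) = enorm z * enorm z `^ (k%:R + tau).
  have -> : k.+1%:R + tau = 1 + (k%:R + tau) by rewrite -natr1; ring.
  rewrite powRD ?powRr1 ?enorm_ge0 //.
  by apply/implyP; rewrite gt_eqF // addr_gt0 // ltr_wpDl.
rewrite mulrCA; apply: ler_pM; [exact: normr_ge0|exact: normr_ge0|exact: le_coord_enorm|].
apply: le_trans h _; rewrite ler_wpM2l // ge0_ler_powR ?nnegrE ?enorm_ge0 ?seg //.
by rewrite addr_ge0 // ltW.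
Qed.

End taylor.

(** * Outer measure of affine images *)

Section lebesgue_outer_theory.
Variables (R : realType) (N : nat).
Implicit Types (x y z : 'rV[R]_N) (A X : set 'rV[R]_N).
Local Notation outer := (@lebesgue_outer R N).
Local Open Scope ereal_scope.

Lemma lebesgue_outer_cover A (D : set nat) (B : nat -> 'rV[R]_N * 'rV[R]_N) :
  A `<=` \bigcup_(k in D) box (B k) -> outer A <= \esum_(k in D) (box_volume (B k))%:E.
Proof. by move=> AB; apply: ereal_inf_lbound; exists (D, B). Qed.

(** The box with the image of the centre of B as its centre and with the
    half-widths of B multiplied by d. *)
Definition affine_box x (c d : R) (B : 'rV[R]_N * 'rV[R]_N) : 'rV[R]_N * 'rV[R]_N :=
  let ctr := (2^-1 *: (B.1 + B.2))%R in let h := (2^-1 *: (B.2 - B.1))%R in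
  ((x + c *: ctr - d *: h)%R, (x + c *: ctr + d *: h)%R).

Lemma affine_box_volume x (c d : R) B : (0 <= d)%R ->
  box_volume (affine_box x c d B) = (d ^+ N * box_volume B)%R.
Proof.
move=> d0; rewrite /box_volume -[X in (d ^+ X)%R]card_ord -prodr_const -big_split /=.
apply: eq_bigr => i _; rewrite !mxE maxr_pMr // mulr0; congr Num.max; by field.
Qed.

(** The inequality |c| < d has to be strict: for negative c the image of a
    half-open box is closed on the side where boxes are open. *)
Lemma affine_boxP x (c d : R) B y : (`|c| < d)%R ->
  box B y -> box (affine_box x c d B) (x + c *: y)%R.
Proof.
move=> cd yB i; have := yB i; rewrite !mxE.
set a := B.1 _ _; set b := B.2 _ _; set t := y _ _ => /andP[at_ tb].
have d0 : (0 < d)%R by apply: le_lt_trans cd.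
have h0 : (0 < 2^-1 * (b - a))%R by lra.
have : (`|c * (t - 2^-1 * (a + b))| < d * (2^-1 * (b - a)))%R.
  rewrite normrM; apply: le_lt_trans (_ : `|c| * (2^-1 * (b - a)) < _)%R.
    by rewrite ler_wpM2l // ler_norml; apply/andP; split; lra.
  by rewrite ltr_pM2r.
by rewrite ltr_norml => /andP[h1 h2]; apply/andP; split; lra.
Qed.

Lemma lebesgue_outer_affine_le_approx x (c d : R) A : (`|c| < d)%R ->
  outer [set x + c *: y | y in A]%R <= (d ^+ N)%:E * outer A.
Proof.
move=> cd; have d0 : (0 < d)%R by apply: le_lt_trans cd.
have dN : (0 < d ^+ N)%R by rewrite exprn_gt0.
rewrite muleC -lee_pdivrMr //; apply: le_ereal_inf_tmp => _ [[D B] /= AB <-].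
rewrite lee_pdivrMr // muleC.
pose B' k := affine_box x c d (B k).
apply: (@le_trans _ _ (\esum_(k in D) (box_volume (B' k))%:E)).
  apply: lebesgue_outer_cover => _ [y /AB[k Dk ky] <-]; exists k => //.
  exact: affine_boxP.
rewrite -[D](@set_mem_set nat).
rewrite -!nneseries_esum; try by move=> *; rewrite lee_fin box_volume_ge0.
rewrite -nneseriesZl; last by move=> *; rewrite lee_fin box_volume_ge0.
by under eq_eseriesr do rewrite affine_box_volume ?(ltW d0) // EFinM.
Qed.

(** The enlargement factor d of the boxes tends to |c|. *)
Lemma lebesgue_outer_affine_le x (c : R) A : c != 0%R ->
  outer [set x + c *: y | y in A]%R <= (`|c| ^+ N)%:E * outer A.
Proof.
move=> c0; have cN : (0 < `|c| ^+ N)%R by rewrite exprn_gt0 ?normr_gt0.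
have := @lebesgue_outer_affine_le_approx x c _ A.
have := lebesgue_outer_ge0 A; case: (outer A) => [b| |] // b0 H; last first.
  by rewrite gt0_muley ?lte_fin // leey.
have H1 := H (`|c| + 1)%R; rewrite ltrDl ltr01 -EFinM in H1.
have := lebesgue_outer_ge0 [set x + c *: y | y in A]%R.
move: H {H1}; case: (outer _) => [a| |] // H _; last first.
  by have := H (`|c| + 1)%R; rewrite ltrDl ltr01 -EFinM => /(_ isT).
rewrite -EFinM lee_fin leNgt; apply/negP => ab.
have ct : {for `|c|%R, continuous (fun d : R => d ^+ N * b)%R}.
  by move=> d; apply: cvgM; [exact: exprn_continuous|exact: cvg_cst].
have nb : \forall d \near `|c|%R^'+, (d ^+ N * b < a)%R.
  apply: (cvgr_lt _ (cvg_at_right_filter ct)).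
  by rewrite -lte_fin EFinM.
near (`|c|%R^'+) => d.
have dc : (`|c| < d)%R by near: d; exact: nbhs_right_gt.
have := H d dc; rewrite -EFinM lee_fin leNgt => /negP; apply.
by near: d.
Unshelve. all: by end_near.
Qed.

End lebesgue_outer_theory.

(** * Measurability and affine changes of variables *)

Section lebesgue_rV_affine.
Variables (R : realType) (N : nat).
Implicit Types (x y z : 'rV[R]_N) (A X : set 'rV[R]_N).
Local Notation outer := (@lebesgue_outer R N).
Local Notation mu := (lebesgue_measure_rV R N).
Local Notation rV := (lebesgue_rV R N).

Definition affine x (c : R) (y : 'rV[R]_N) : 'rV[R]_N := x + c *: y.

(** The reverse inequality is the same estimate for the inverse map. *)
Lemma lebesgue_outer_affine x (c : R) A : c != 0 ->
  (outer (affine x c @` A) = (`|c| ^+ N)%:E * outer A)%E.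
Proof.
move=> c0; apply/eqP; rewrite eq_le lebesgue_outer_affine_le //=.
have cN : 0 < `|c| ^+ N by rewrite exprn_gt0 ?normr_gt0.
rewrite muleC -lee_pdivlMr //.
have -> : A = affine (- (c^-1 *: x)) c^-1 @` (affine x c @` A).
  apply/seteqP; split => [y Ay|_ [_ [y Ay <-] <-]].
    exists (affine x c y); first by exists y.
    by rewrite /affine scalerDr scalerA mulVf // scale1r addKr.
  by rewrite /affine scalerDr scalerA mulVf // scale1r addKr.
have -> : affine x c @` (affine (- (c^-1 *: x)) c^-1 @` (affine x c @` A)) = affine x c @` A.
  apply/seteqP; split => [_ [_ [_ [y Ay <-] <-] <-]|_ [y Ay <-]].
    exists y => //; rewrite /affine.
    by rewrite [in RHS]scalerDr scalerN !scalerA mulfV // scale1r scale1r addNKr.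
  exists y; last by [].
  exists (affine x c y); first by exists y.
  by rewrite /affine scalerDr scalerA mulVf // scale1r addKr.
rewrite muleC; have := @lebesgue_outer_affine_le R N (- (c^-1 *: x)) c^-1 (affine x c @` A).
by rewrite normfV exprVn; apply; rewrite invr_eq0.
Qed.

Lemma lebesgue_outer_preimage x (c : R) A : c != 0 ->
  (outer (affine x c @^-1` A) = (`|c| ^- N)%:E * outer A)%E.
Proof.
move=> c0; have cN : 0 < `|c| ^+ N by rewrite exprn_gt0 ?normr_gt0.
have {2}-> : A = affine x c @` (affine x c @^-1` A).
  apply/seteqP; split => [y Ay|_ [y Ay <-] //].
  exists (c^-1 *: (y - x)); rewrite /preimage /= /affine scalerA mulfV // scale1r addrC subrK //.
by rewrite lebesgue_outer_affine // muleA -EFinM mulVf ?mul1e // gt_eqF.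
Qed.

Lemma measurable_rVE A : measurable (A : set rV) = caratheodory_measurable outer A.
Proof. by []. Qed.

(** The Caratheodory criterion involves only the outer measure, which the map
    multiplies by a constant. *)
Lemma measurable_affine x (c : R) : c != 0 ->
  measurable_fun setT (affine x c : rV -> rV).
Proof.
move=> c0 _ A mA; rewrite setTI measurable_rVE => X.
have img Y : (outer Y = (`|c| ^- N)%:E * outer (affine x c @` Y))%E.
  rewrite -(lebesgue_outer_preimage x) //; congr outer.
  apply/seteqP; split => [y Yy|y [z Yz]]; first by exists y.
  by move=> /addrI /(scalerI c0) <-.
rewrite measurable_rVE in mA.
rewrite (img X) (mA (affine x c @` X)) ge0_muleDr ?lebesgue_outer_ge0 //.
congr (_ + _)%E; rewrite [RHS]img; congr (_ * outer _)%E.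
- apply/seteqP; split => [_ [[y Xy <-] Ay]|_ [y [Xy Ay] <-]]; first by exists y.
  by split => //; exists y.
- apply/seteqP; split => [_ [[y Xy <-] Ay]|_ [y [Xy Ay] <-]]; first by exists y.
  by split => //; exists y.
Qed.

Lemma lebesgue_measure_preimage x (c : R) A : c != 0 ->
  (mu (affine x c @^-1` A) = (`|c| ^- N)%:E * mu A)%E.
Proof. exact: lebesgue_outer_preimage. Qed.

(** The part of a box in the half-space x_i <= a; the half-open convention
    makes it, and the complementary part, boxes again. *)
Definition box_below (i : 'I_N) (a : R) (B : 'rV[R]_N * 'rV[R]_N) : 'rV[R]_N * 'rV[R]_N :=
  (B.1, \row_j (if j == i then Num.min (B.2 ord0 j) a else B.2 ord0 j)).

Definition box_above (i : 'I_N) (a : R) (B : 'rV[R]_N * 'rV[R]_N) : 'rV[R]_N * 'rV[R]_N :=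
  (\row_j (if j == i then Num.max (B.1 ord0 j) a else B.1 ord0 j), B.2).

Lemma box_volume_split i a B :
  box_volume B = box_volume (box_below i a B) + box_volume (box_above i a B).
Proof.
pose w (C : 'rV[R]_N * 'rV[R]_N) := \prod_(j < N | j != i) Num.max 0 (C.2 ord0 j - C.1 ord0 j).
have vE C : box_volume C = Num.max 0 (C.2 ord0 i - C.1 ord0 i) * w C.
  by rewrite /box_volume (bigD1 i).
have -> : box_volume (box_below i a B) = Num.max 0 (Num.min (B.2 ord0 i) a - B.1 ord0 i) * w B.
  rewrite vE /= mxE eqxx; congr (_ * _).
  by apply: eq_bigr => j /negbTE ji; rewrite /= mxE ji.
have -> : box_volume (box_above i a B) = Num.max 0 (B.2 ord0 i - Num.max (B.1 ord0 i) a) * w B.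
  rewrite vE /= mxE eqxx; congr (_ * _).
  by apply: eq_bigr => j /negbTE ji; rewrite /= mxE ji.
rewrite vE -mulrDl; congr (_ * _).
set p := B.1 _ _; set q := B.2 _ _.
have [qa|aq] := lerP q a; have [pa|ap] := lerP p a;
  rewrite /Num.max; repeat (case: ltP => ?); lra.
Qed.

(** A hyperplane orthogonal to an axis splits each box of a cover into two
    boxes whose volumes add up exactly. *)
Lemma measurable_coord_le (i : 'I_N) (a : R) : measurable ([set x | x ord0 i <= a] : set rV).
Proof.
rewrite measurable_rVE; apply: le_caratheodory_measurable => X.
apply: le_ereal_inf_tmp => _ [[D B] /= XB <-].
apply: (@le_trans _ _ (\esum_(k in D) (box_volume (box_below i a (B k)))%:E +
  \esum_(k in D) (box_volume (box_above i a (B k)))%:E)%E).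
  apply: leeD; apply: lebesgue_outer_cover => y [/XB[k Dk By]] /= ya; exists k => // j /=.
  - by have := By j; rewrite mxE; case: eqP => [->|//]; rewrite le_min ya andbT.
  - have := By j; rewrite mxE; case: eqP => [->|//]; rewrite gt_max => /andP[-> ->].
    by rewrite ltNge; apply/andP; split => //; apply/andP; split => //; apply/negP.
rewrite -esumD; try by move=> *; rewrite lee_fin box_volume_ge0.
by under [leRHS]eq_esum do rewrite (box_volume_split i a) EFinD.
Qed.

Lemma measurable_coord (i : 'I_N) : measurable_fun setT (fun x : rV => x ord0 i : R).
Proof.
apply: (measurability _ (RGenOInfty.measurableE R)) => _ [_ [a ->] <-].
rewrite setTI; have := measurableC (measurable_coord_le i a); congr measurable.
apply/seteqP; split => y /=; rewrite in_itv /= andbT => h.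
  by rewrite ltNge; apply/negP.
by apply/negP; rewrite -ltNge.
Qed.

Lemma measurable_enorm : measurable_fun setT (@enorm R N : rV -> R).
Proof.
have -> : (@enorm R N : rV -> R) = (fun t : R => t `^ 2^-1) \o (fun x : rV => \sum_(i < N) x ord0 i ^+ 2).
  apply/funext => x /=; rewrite powR12_sqrt //.
  by apply: sumr_ge0 => i _; exact: sqr_ge0.
apply: measurableT_comp; first exact: measurable_powR.
apply: measurable_sum => i; under eq_fun do rewrite expr2.
by apply: measurable_funM; exact: measurable_coord.
Qed.

Lemma measurable_hpoly (l : nat) (p : 'rV[R]_N -> R) : hpoly l p ->
  measurable_fun setT (p : rV -> R).
Proof.
elim: l p => [|l IH] p /=.
  by move=> [c pc]; rewrite (_ : p = cst c) //; apply/funext.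
move=> [q ql pq]; rewrite (_ : p = fun z => \sum_(i < N) z ord0 i * q i z); last exact/funext.
apply: measurable_sum => i; apply: measurable_funM; first exact: measurable_coord.
exact: IH.
Qed.

Lemma bounded_measure_lty (r : R) : (mu [set x | (enorm x <= r)%R] < +oo)%E.
Proof.
pose B : 'rV[R]_N * 'rV[R]_N := (const_mx (- r - 1), const_mx r).
apply: (@le_lt_trans _ _ (\esum_(k in [set 0%N]) (box_volume B)%:E)%E).
  apply: lebesgue_outer_cover => y /= yr; exists 0%N => // i; rewrite !mxE.
  have := le_trans (le_coord_enorm y i) yr; rewrite ler_norml => /andP[h1 ->].
  by rewrite andbT; lra.
by rewrite esum_set1 ?ltry // lee_fin box_volume_ge0.
Qed.

Lemma pushforward_affine x (c : R) (A : set rV) : c != 0 -> measurable A ->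
  pushforward mu (affine x c : rV -> rV) A = mscale (NngNum (exprn_ge0 N (normr_ge0 c^-1))) mu A.
Proof.
move=> c0 mA; rewrite /pushforward /mscale /= lebesgue_measure_preimage //.
by rewrite normfV exprVn.
Qed.

Lemma ge0_integral_affine x (c : R) (f : rV -> \bar R) : c != 0 ->
  measurable_fun [set: rV] f -> (forall y, 0 <= f y)%E ->
  (\int[mu]_y f (affine x c y) = (`|c| ^- N)%:E * \int[mu]_y f y)%E.
Proof.
move=> c0 mf f0; have mphi := measurable_affine x c0.
have := @ge0_integral_pushforward _ _ rV rV R (affine x c) mphi mu setT f measurableT mf (fun y _ => f0 y).
rewrite preimage_setT => <-.
rewrite (@eq_measure_integral _ _ _ setT (mscale (NngNum (exprn_ge0 N (normr_ge0 c^-1))) mu)).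
  by rewrite ge0_integral_mscale //= normfV exprVn.
by move=> A mA _; exact: pushforward_affine.
Qed.

End lebesgue_rV_affine.

(** * Integrable functions *)

Section lebesgue_rV_integral.
Variables (R : realType) (N : nat).
Local Notation mu := (lebesgue_measure_rV R N).
Local Notation rV := (lebesgue_rV R N).
Local Notation intg f := (mu.-integrable [set: rV] (EFin \o (f : rV -> R))).
Implicit Types (f g : rV -> R) (x y : 'rV[R]_N).

Lemma integrable_measurable f : intg f -> measurable_fun [set: rV] f.
Proof. by move=> /measurable_int; rewrite measurable_EFinP. Qed.

Lemma integrable_dominated f g : measurable_fun [set: rV] f ->
  (forall y, `|f y| <= g y) -> intg g -> intg f.
Proof.
move=> mf fg ig; apply: (le_integrable measurableT _ _ ig); first exact/measurable_EFinP.
by move=> y _ /=; rewrite lee_fin (le_trans (fg y)) // ler_norm.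
Qed.

Lemma integrableRD f g : intg f -> intg g -> intg (fun y => f y + g y).
Proof. by move=> ? ?; apply: (@eq_integrable _ _ _ _ _ _ ((EFin \o f) \+ (EFin \o g))%E) => //; apply: integrableD. Qed.

Lemma integrableRZ (k : R) f : intg f -> intg (fun y => k * f y).
Proof. by move=> h; apply: (eq_integrable measurableT _ _ _ (integrableZl measurableT k h)). Qed.

Lemma integrableR_sum (I : Type) (s : seq I) (F : I -> rV -> R) :
  (forall i, intg (F i)) -> intg (fun y => \sum_(i <- s) F i y).
Proof.
move=> iF; elim: s => [|i s IH].
  by under eq_fun do rewrite big_nil; exact: integrable0.
by under eq_fun do rewrite big_cons; exact: integrableRD.
Qed.

Lemma Rintegral_sumZ (I : Type) (s : seq I) (b : I -> R) (F : I -> rV -> R) :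
  (forall i, intg (F i)) ->
  \int[mu]_y (\sum_(i <- s) b i * F i y) = \sum_(i <- s) b i * \int[mu]_y F i y.
Proof.
move=> iF; elim: s => [|i s IH].
  under eq_Rintegral do rewrite big_nil.
  by rewrite big_nil Rintegral_cst // mul0r.
under eq_Rintegral do rewrite big_cons.
rewrite big_cons RintegralD //.
- by rewrite RintegralZl // IH.
- exact: integrableRZ.
- by apply: integrableR_sum => j; exact: integrableRZ.
Qed.

Lemma measurable_comp_affine x (c : R) f : c != 0 -> measurable_fun [set: rV] f ->
  measurable_fun [set: rV] (fun y : rV => f (affine x c y)).
Proof. by move=> c0 mf; apply: (measurableT_comp mf); exact: measurable_affine. Qed.

Lemma integrable_affine x (c : R) f : c != 0 -> intg f -> intg (fun y => f (affine x c y)).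
Proof.
move=> c0 /integrableP[/measurable_EFinP mf fo]; apply/integrableP; split.
  exact/measurable_EFinP/measurable_comp_affine.
have mnf : measurable_fun [set: rV] (fun y => `|(f y)%:E|%E).
  exact/measurableT_comp/measurable_EFinP.
rewrite (ge0_integral_affine x c0 mnf (fun y => abse_ge0 _)).
by rewrite lte_mul_pinfty // ?lee_fin ?invr_ge0 ?exprn_ge0.
Qed.

(** The case of nonnegative functions is applied to both terms of
    f = (|f| + f) - |f|. *)
Lemma Rintegral_affine x (c : R) f : c != 0 -> intg f ->
  \int[mu]_y f (affine x c y) = `|c| ^- N * \int[mu]_y f y.
Proof.
move=> c0.
have ge0 g : (forall y, 0 <= g y) -> intg g ->
    \int[mu]_y g (affine x c y) = `|c| ^- N * \int[mu]_y g y.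
  move=> g0 ig; rewrite /Rintegral.
  have mg : measurable_fun [set: rV] (EFin \o g).
    exact/measurable_EFinP/integrable_measurable.
  have g0' y : (0 <= (EFin \o g) y)%E by rewrite lee_fin.
  rewrite (ge0_integral_affine x c0 mg g0').
  by rewrite fineM // integrable_fin_num.
move=> fi; have ai : intg (fun y => `|f y|) by exact: (integrable_norm fi).
have fE g : intg g -> \int[mu]_y g y = \int[mu]_y (`|g y| + g y) - \int[mu]_y `|g y|.
  move=> gi; rewrite -RintegralB //.
  - by apply: eq_Rintegral => y _; rewrite addrAC subrr add0r.
  - by apply: integrableRD => //; exact: (integrable_norm gi).
  - exact: (integrable_norm gi).
rewrite [in RHS]fE // mulrBr -!ge0 //; last 2 first.
- by move=> y; rewrite -lerBlDr sub0r ler_normr lexx orbT.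
- exact: integrableRD.
by rewrite [LHS]fE //; exact: integrable_affine.
Qed.

Lemma measurable_enorm_set (i : interval R) :
  measurable ([set y | enorm y \in i] : set rV).
Proof.
have := @measurable_enorm R N measurableT _ (measurable_itv i).
by rewrite setTI.
Qed.

Lemma measurable_enorm_in (i : interval R) :
  measurable_fun [set: rV] (fun y : rV => (enorm y \in i)%:R : R).
Proof.
have := @measurable_indic _ rV R setT _ (measurable_enorm_set i).
congr measurable_fun; apply/funext => y; rewrite indicE.
by congr (nat_of_bool _)%:R; rewrite mem_setE.
Qed.

Lemma integrable_indic_lty (A : set rV) : measurable A -> (mu A < +oo)%E ->
  intg (\1_A : rV -> R).
Proof.
move=> mA Ao; apply/integrableP; split.
  by apply/measurable_EFinP; exact: measurable_indic.
under eq_integral do rewrite /= ger0_norm //.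
by rewrite integral_indic // setIT.
Qed.

Lemma integrable_bounded_support (C b : R) f : measurable_fun [set: rV] f ->
  (forall y, `|f y| <= C * (enorm y <= b)%R%:R) -> intg f.
Proof.
move=> mf fC; have bo := @bounded_measure_lty R N b.
have mb : measurable ([set y | (enorm y <= b)%R] : set rV).
  rewrite (_ : mkset _ = [set y | enorm y \in `]-oo, b]]); first exact: measurable_enorm_set.
  by apply/seteqP; split => y /=; rewrite in_itv.
apply: (integrable_dominated mf _ (integrableRZ C (integrable_indic_lty mb bo))).
move=> y; apply: le_trans (fC y) _; rewrite indicE.
case: (boolP (enorm y <= b)) => h; first by rewrite mem_set.
by rewrite memNset //=; apply/negP.
Qed.

(** Let g be |y|^e on the shell 1 < |y| <= 2 and 0 elsewhere. On the i-th
    shell |y|^e equals F i y = lam^(i e) g(lam^-i y), whose integral is, by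
    scaling, the i-th term of a geometric series of ratio
    q = lam^(N + e) < 1. *)
Lemma integrable_dyadic (lam e : R) f : 0 < lam -> lam `^ (N%:R + e) < 1 ->
  measurable_fun [set: rV] f ->
  (forall y, f y != 0 -> `|f y| <= enorm y `^ e /\
     exists i : nat, lam ^+ i < enorm y <= lam ^+ i * 2) -> intg f.
Proof.
move=> lam0; set q := lam `^ _ => q1 mf fP.
pose g (y : rV) : R := enorm y `^ e * (enorm y \in `]1, 2])%:R.
have ig : intg g.
  apply: (@integrable_bounded_support (2 `^ `|e|) 2).
    apply: measurable_funM; last exact: measurable_enorm_in.
    by apply: (measurableT_comp (measurable_powR e)); exact: measurable_enorm.
  move=> y; rewrite /g in_itv /=; case: (boolP (1 < enorm y <= 2)) => [/andP[y1 y2]|_]; last first.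
    by rewrite mulr0 normr0 mulr_ge0 ?powR_ge0.
  rewrite y2 !mulr1 ger0_norm ?powR_ge0 //.
  apply: (@le_trans _ _ (enorm y `^ `|e|)).
    by apply: ler_powR; [exact: ltW|exact: ler_norm].
  by rewrite ge0_ler_powR ?nnegrE ?enorm_ge0.
pose A := \int[mu]_y g y.
have A0 : 0 <= A by apply: Rintegral_ge0 => y _; rewrite mulr_ge0 ?powR_ge0.
pose F i (y : rV) := lam `^ (i%:R * e) * g (affine 0 (lam ^- i) y).
have li i : lam ^- i != 0 by rewrite invr_eq0 expf_neq0 ?gt_eqF.
have iF i : intg (F i) by apply: integrableRZ; exact: integrable_affine.
have F0 i y : 0 <= F i y by rewrite mulr_ge0 ?mulr_ge0 ?powR_ge0.
have mF i : measurable_fun [set: rV] (fun y => (F i y)%:E).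
  exact/measurable_EFinP/integrable_measurable.
have AF i : \int[mu]_y F i y = q ^+ i * A.
  rewrite (RintegralZl _ measurableT (integrable_affine 0 (li i) ig)).
  rewrite (Rintegral_affine 0 (li i) ig) mulrA; congr (_ * _).
  have -> : q ^+ i = lam `^ (i%:R * e + i%:R * N%:R).
    by rewrite -powR_mulrn ?powR_ge0 // -powRrM; congr powR; ring.
  rewrite gtr0_norm ?invr_gt0 ?exprn_gt0 // exprVn invrK -exprM.
  rewrite powRD; last by rewrite (gt_eqF lam0) implybT.
  by rewrite -natrM powR_mulrn // ltW.
apply/integrableP; split; first exact/measurable_EFinP.
apply: (@le_lt_trans _ _ (\int[mu]_y \sum_(0 <= i <oo) (F i y)%:E)%E).
  apply: ge0_le_integral; first exact: measurableT.
  - by move=> y _; exact: abse_ge0.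
  - exact/measurableT_comp/measurable_EFinP.
  - apply: ge0_emeasurable_sum => [k y _ _|i _]; first by rewrite lee_fin.
    exact: mF.
  move=> y _ /=; case: (eqVneq (f y) 0) => [->|/fP[fe [i yi]]].
    by rewrite normr0; apply: nneseries_ge0 => k _ _; rewrite lee_fin.
  apply: (@le_trans _ _ (F i y)%:E).
    rewrite lee_fin (le_trans fe) // /F /g /affine add0r enormZ.
    have l0 : 0 < lam ^+ i by rewrite exprn_gt0.
    rewrite gtr0_norm ?invr_gt0 // in_itv /= ltr_pdivlMl // mulr1 ler_pdivrMl // yi mulr1.
    rewrite mulrC powRM ?enorm_ge0 ?invr_ge0 ?(ltW l0) // mulrAC.
    rewrite -{1}[lam ^+ i]powR_mulrn ?(ltW lam0) // -powRN -powRrM -powRD.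
      by rewrite mulNr addNr powRr0 mul1r.
    by rewrite (gt_eqF lam0) implybT.
  apply: le_trans (nneseries_lim_ge i.+1 _); last by move=> k *; rewrite lee_fin.
  rewrite big_nat_recr //= leeDr // sume_ge0 // => k _; by rewrite lee_fin.
have F0' i y : [set: rV] y -> (0 <= (F i y)%:E)%E by rewrite lee_fin.
rewrite (integral_nneseries mu measurableT mF F0').
apply: (@le_lt_trans _ _ (A / (1 - q))%:E); last exact: ltry.
apply: lime_le.
  by apply: is_cvg_nneseries => k _ _; apply: integral_ge0 => y _; rewrite lee_fin.
apply: nearW => n; rewrite big_mkord.
have E i : (\int[mu]_y (F i y)%:E)%E = (q ^+ i * A)%:E.
  rewrite -AF /Rintegral fineK //; apply: (integrable_fin_num measurableT); exact: (iF i).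
under eq_bigr do rewrite E.
rewrite sumEFin lee_fin; elim: n => [|n IH].
  by rewrite big_ord0 divr_ge0 // subr_ge0 ltW.
rewrite big_ord_recl expr0 mul1r; under eq_bigr do rewrite exprS -mulrA.
rewrite -mulr_sumr.
have nz : 1 - q != 0 by rewrite subr_eq0 gt_eqF.
have -> : A / (1 - q) = A + q * (A / (1 - q)) by field.
by rewrite lerD2l ler_wpM2l // powR_ge0.
Qed.

End lebesgue_rV_integral.

(** * Powers of the norm and logarithmic shells *)

Section power_integrability.
Variables (R : realType) (N : nat).
Local Notation mu := (lebesgue_measure_rV R N).
Local Notation rV := (lebesgue_rV R N).
Local Notation intg f := (mu.-integrable [set: rV] (EFin \o (f : rV -> R))).
Implicit Types (f g : rV -> R) (x y : 'rV[R]_N).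

Lemma dyadic_scale_up (t : R) : 1 < t -> exists i : nat, 2 ^+ i < t <= 2 ^+ i * 2.
Proof.
move=> t1; have ex : exists i : nat, t <= 2 ^+ i * 2.
  exists (Num.truncn t).+1; apply: le_trans (ltW (truncnS_gt t)) _.
  rewrite -exprSr -natrX ler_nat; apply: ltnW; apply: ltn_trans (ltnSn _) _.
  exact: ltn_expl.
case: (ex_minnP ex) => i ti imin; exists i; rewrite ti andbT.
case: i ti imin => [|i] ti imin; first by rewrite expr0.
rewrite ltNge; apply/negP; rewrite exprSr => /imin; by rewrite ltnn.
Qed.

Lemma dyadic_scale_down (t : R) : 0 < t <= 1 ->
  exists i : nat, 2^-1 ^+ i < t <= 2^-1 ^+ i * 2.
Proof.
move=> /andP[t0 t1]; have ex : exists i : nat, 2^-1 ^+ i < t.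
  exists (Num.truncn t^-1).+1; rewrite exprVn invf_plt ?posrE ?exprn_gt0 //.
  apply: lt_le_trans (truncnS_gt _) _.
  by rewrite -natrX ler_nat ltnW // ltn_expl.
case: (ex_minnP ex) => i ti imin; exists i; rewrite ti /=.
case: i ti imin => [|i] ti imin.
  by rewrite expr0 mul1r; apply: le_trans t1 _; rewrite ler1n.
by rewrite exprSr mulfVK // leNgt; apply/negP => /imin; rewrite ltnn.
Qed.

Let measurable_powR_in (e : R) (i : interval R) :
  measurable_fun [set: rV] (fun y : rV => enorm y `^ e * (enorm y \in i)%:R : R).
Proof.
apply: measurable_funM; last exact: measurable_enorm_in.
by apply: (measurableT_comp (measurable_powR e)); exact: measurable_enorm.
Qed.

Let powR_lt1 (a e : R) : 0 < a -> e * ln a < 0 -> a `^ e < 1.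
Proof. by move=> a0 ea; rewrite /powR gt_eqF // -expR0 ltr_expR. Qed.

Let ln2_gt0 : 0 < ln 2 :> R. Proof. by rewrite ln_gt0 // ltr1n. Qed.

(** The shells with ratio lam = 1/2 exhaust the punctured ball. *)
Lemma integrable_powR_near0 (e : R) : - N%:R < e ->
  intg (fun y => enorm y `^ e * (enorm y \in `]0, 1])%:R).
Proof.
move=> Ne; apply: (@integrable_dyadic _ _ 2^-1 e) => //.
  by rewrite powR_lt1 // lnV ?posrE // mulrN oppr_lt0 mulr_gt0 // -ltrBlDl sub0r.
move=> y; rewrite in_itv /=; case: (boolP (0 < enorm y <= 1)) => [h _|]; last by rewrite mulr0 eqxx.
by rewrite mulr1 ger0_norm ?powR_ge0; split => //; exact: dyadic_scale_down.
Qed.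

(** The shells with ratio lam = 2 exhaust the exterior of the unit ball; other
    radii follow by scaling. *)
Lemma integrable_powR_infty (e r : R) : e < - N%:R -> 0 < r ->
  intg (fun y => enorm y `^ e * (enorm y \in `]r, +oo[)%:R).
Proof.
move=> eN r0.
have i1 : intg (fun y => enorm y `^ e * (enorm y \in `]1, +oo[)%:R).
  apply: (@integrable_dyadic _ _ 2 e) => //.
    by rewrite powR_lt1 // nmulr_rlt0 // -ltrBrDl sub0r.
  move=> y; rewrite in_itv /= andbT; case: (boolP (1 < enorm y)) => [h _|]; last by rewrite mulr0 eqxx.
  by rewrite mulr1 ger0_norm ?powR_ge0; split => //; exact: dyadic_scale_up.
have rV0 : r^-1 != 0 by rewrite invr_eq0 gt_eqF.
have := integrableRZ (r `^ e) (integrable_affine 0 rV0 i1).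
apply: (eq_integrable measurableT) => y _ /=; congr EFin.
rewrite /affine add0r enormZ gtr0_norm ?invr_gt0 // !in_itv /= !andbT.
rewrite ltr_pdivlMl // mulr1 powRM ?enorm_ge0 ?invr_ge0 ?(ltW r0) //.
rewrite !mulrA -powRM ?invr_ge0 ?(ltW r0) // mulfV ?gt_eqF //.
by rewrite powR1 mul1r.
Qed.

Lemma integrable_log_shell (h : rV -> R) (C rho : R) : 0 < rho -> measurable_fun [set: rV] h ->
  (forall y, `|h y| <= C * enorm y `^ (- N%:R)) ->
  forall k : nat, (0 < k)%N -> intg (fun y => h y * (enorm y <= rho < k%:R * enorm y)%R%:R).
Proof.
move=> rho0 mh hC k k0; have k0' : 0 < k%:R :> R by rewrite ltr0n.
apply: (@integrable_bounded_support _ _ (`|C| * (rho / k%:R) `^ (- N%:R)) rho).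
  rewrite (_ : (fun y => _) = (fun y => h y * (enorm y \in `]rho / k%:R, rho])%:R)).
    by apply: measurable_funM; [exact: mh|exact: measurable_enorm_in].
  apply/funext => y; rewrite in_itv /= ltr_pdivrMr // andbC.
  by rewrite [enorm y * _]mulrC.
move=> y; case: (boolP (enorm y <= rho < _)) => [/andP[yr ry]|_]; last first.
  by rewrite mulr0 normr0 !mulr_ge0 ?powR_ge0.
rewrite yr !mulr1; apply: le_trans (hC y) _.
apply: (@le_trans _ _ (`|C| * enorm y `^ (- N%:R))).
  by rewrite ler_wpM2r ?powR_ge0 // ler_norm.
have rk : 0 < rho / k%:R by rewrite divr_gt0.
have ky : rho / k%:R < enorm y by rewrite ltr_pdivrMr // mulrC.
have y0 : 0 < enorm y := lt_trans rk ky.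
rewrite ler_wpM2l // !powRN lef_pV2 ?posrE ?powR_gt0 //.
by rewrite ge0_ler_powR ?nnegrE ?enorm_ge0 // ltW.
Qed.

(** The measure h(y) dy is invariant under y |-> a y. The shell for the product
    a b is the disjoint union of the shell for a and of the image of the
    shell for b under y |-> a^-1 y, so the mass is additive; it is monotone
    since h is nonnegative. *)
Lemma Rintegral_log_shell_ge0 (h : rV -> R) (C rho : R) :
  0 < rho -> measurable_fun [set: rV] h -> (forall y, 0 <= h y) ->
  (forall y, `|h y| <= C * enorm y `^ (- N%:R)) ->
  (forall (k : nat) y, (0 < k)%N -> h (k%:R *: y) = k%:R ^- N * h y) ->
  exists c, forall k : nat, (0 < k)%N ->
    \int[mu]_y (h y * (enorm y <= rho < k%:R * enorm y)%R%:R) = c * ln k%:R.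
Proof.
move=> rho0 mh h0 hC hh; have ih := integrable_log_shell rho0 mh hC.
pose H k := \int[mu]_y (h y * (enorm y <= rho < k%:R * enorm y)%R%:R).
exists (H 2%N / ln 2); apply: (@monotone_additive_ln _ H) => [a b a0 b0|a b a0 ab].
- have aN : a%:R != 0 :> R by rewrite pnatr_eq0 -lt0n.
  pose F (y : rV) := h y * (enorm y <= rho < b%:R * enorm y)%R%:R.
  pose G (y : rV) := h y * (a%:R * enorm y <= rho < (a * b)%:R * enorm y)%R%:R.
  have GF : G = (fun y => `|a%:R| ^+ N * F (affine 0 a%:R y)).
    apply/funext => y; rewrite /G /F /affine add0r hh // enormZ ger0_norm //.
    by rewrite !mulrA mulfV ?expf_neq0 // mul1r natrM [b%:R * a%:R]mulrC.
  have iG : intg G by rewrite GF; apply: integrableRZ; apply: integrable_affine => //; exact: ih.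
  have bE : H b = \int[mu]_y G y.
    rewrite GF RintegralZl //; last by apply: integrable_affine => //; exact: ih.
    rewrite Rintegral_affine //; last exact: ih.
    by rewrite mulrA mulfV ?expf_neq0 ?normr_eq0 // mul1r.
  rewrite bE /H -RintegralD //; last exact: ih.
  apply: eq_Rintegral => y _; rewrite -mulrDr; congr (_ * _).
  have t0 := enorm_ge0 y; set t := enorm y in t0 *.
  have a1 : 1 <= a%:R :> R by rewrite ler1n.
  have b1 : 1 <= b%:R :> R by rewrite ler1n.
  have ta : t <= a%:R * t by rewrite ler_peMl.
  have tb : a%:R * t <= (a * b)%:R * t by rewrite natrM mulrAC ler_peMr // mulr_ge0.
  rewrite -natrD; congr (_%:R).
  by case: (lerP t rho); case: (lerP (a%:R * t) rho); case: (lerP ((a * b)%:R * t) rho) => //= *; exfalso; lra.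
- have b0 : (0 < b)%N by exact: leq_trans ab.
  apply: le_Rintegral => //; [exact: ih|exact: ih|move=> y _].
  rewrite ler_wpM2l // ler_nat; case: (lerP (enorm y) rho) => //= _.
  case: (ltrP rho (a%:R * enorm y)) => //= h1.
  by rewrite (lt_le_trans h1) // ler_wpM2r ?enorm_ge0 // ler_nat.
Qed.

Lemma Rintegral_log_shell (h : rV -> R) (C rho : R) :
  0 < rho -> measurable_fun [set: rV] h ->
  (forall y, `|h y| <= C * enorm y `^ (- N%:R)) ->
  (forall (k : nat) y, (0 < k)%N -> h (k%:R *: y) = k%:R ^- N * h y) ->
  exists c, forall k : nat, (0 < k)%N ->
    \int[mu]_y (h y * (enorm y <= rho < k%:R * enorm y)%R%:R) = c * ln k%:R.
Proof.
move=> rho0 mh hC hh.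
have ma : measurable_fun [set: rV] (fun y => `|h y|) by exact: measurableT_comp.
have [|||c1 c1P] := @Rintegral_log_shell_ge0 (fun y => `|h y|) C rho rho0 ma.
- by [].
- by move=> y; rewrite normr_id.
- by move=> k y k0; rewrite hh // normrM ger0_norm // invr_ge0 exprn_ge0.
have h2C y : `|(fun y => `|h y| + h y) y| <= 2 * C * enorm y `^ (- N%:R).
  apply: le_trans (ler_normD _ _) _; rewrite normr_id.
  by have := hC y; lra.
have [|||c2 c2P] := @Rintegral_log_shell_ge0 (fun y => `|h y| + h y) (2 * C) rho rho0
  (measurable_funD ma mh).
- by move=> y; rewrite -lerBlDr sub0r ler_normr lexx orbT.
- exact: h2C.
- move=> k y k0; rewrite hh // normrM [`|k%:R ^- N|]ger0_norm ?invr_ge0 ?exprn_ge0 //.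
  by rewrite mulrDr.
exists (c2 - c1) => k k0; rewrite mulrBl -c1P // -c2P // -RintegralB //.
- by apply: eq_Rintegral => y _; rewrite -mulrBl addrAC subrr add0r.
- exact: (integrable_log_shell rho0 (measurable_funD ma mh) h2C k0).
- by apply: (integrable_log_shell (C := C) rho0 ma _ k0) => y; rewrite normr_id.
Qed.
End power_integrability.

(** * The regularized even part *)

(** The terms of odd degree of the expansions at z and at -z cancel. The
    constant term is identified by evaluating at z = 0. *)
Lemma even_part_taylor (R : realType) (N : nat) (U : set 'rV[R]_N) (t : R)
    (u : 'rV[R]_N -> R) (x : 'rV[R]_N) : open U -> U x -> Ct t U u ->
  exists (k : nat) (p : nat -> 'rV[R]_N -> R) (C r : R),
    [/\ t <= k.+1%:R, forall l, hpoly l (p l), forall z, p 0%N z = u x, 0 < r &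
     0 <= C /\ forall z, enorm z < r ->
       `|(u (x + z) + u (x - z)) / 2 - \sum_(l < k.+1) (~~ odd l)%:R * p l z|
         <= C * enorm z `^ t].
Proof.
move=> Uo Ux [k [tau [tE /andP[tau0 tau1] uk uh]]].
have [p hp [C [r [C0 r0 pP]]]] := taylor Uo Ux tau0 uk uh.
exists k, p, C, r; split => //.
- by rewrite tE -natr1 lerD2l.
- move=> z; have [c pc] := hp 0%N; rewrite pc -(pc 0).
  have := pP 0; rewrite enorm0 addr0 powR0; last by rewrite gt_eqF // ltr_wpDl.
  rewrite mulr0 => /(_ r0); rewrite normr_le0 subr_eq0 big_ord_recl big1 ?addr0.
    by move/eqP->.
  by move=> l _ /=; rewrite -(scale0r 0) (hpoly_homogeneous 0 0 (hp _)) exprS !mul0r.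
split => // z zr; have := pP z zr; have := pP (- z); rewrite enormN => /(_ zr).
have -> : \sum_(l < k.+1) (~~ odd l)%:R * p l z =
    (\sum_(l < k.+1) p l z + \sum_(l < k.+1) p l (- z)) / 2.
  rewrite -big_split mulr_suml; apply: eq_bigr => l _ /=.
  rewrite -scaleN1r (hpoly_homogeneous (-1) z (hp l)) -signr_odd.
  by case: (odd l); rewrite ?expr1 ?expr0 /=; field.
rewrite -tE; set E := C * _; set a := \sum_(l < _) _; set b := \sum_(l < _) _.
rewrite !ler_norml => /andP[? ?] /andP[? ?]; apply/andP; split; lra.
Qed.

Section polynomial_parts.
Variables (R : realType) (N k : nat) (p : nat -> 'rV[R]_N -> R).
Hypothesis hp : forall l, hpoly l (p l).
Local Notation rV := (lebesgue_rV R N).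

Definition psum (P : pred nat) (z : 'rV[R]_N) : R := \sum_(l < k.+1) (P l)%:R * p l z.

Lemma measurable_psum P : measurable_fun [set: rV] (psum P : rV -> R).
Proof.
apply: measurable_sum => l; apply: measurable_funM; first exact: measurable_cst.
exact: measurable_hpoly.
Qed.

Lemma psum_homogeneous P (t : R) z :
  psum P (t *: z) = \sum_(l < k.+1) (P l)%:R * t ^+ l * p l z.
Proof. by apply: eq_bigr => l _; rewrite (hpoly_homogeneous _ _ (hp l)) mulrA. Qed.

Lemma psum_bound : exists2 B : nat -> R, (forall l, 0 <= B l) &
  forall P z, `|psum P z| <= \sum_(l < k.+1) (P l)%:R * B l * enorm z ^+ l.
Proof.
have [B BP] : {B : nat -> R & forall l, 0 <= B l /\ forall z, `|p l z| <= B l * enorm z ^+ l}.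
  apply: (@choice _ _ (fun l b => 0 <= b /\ forall z, `|p l z| <= b * enorm z ^+ l)) => l.
  by have [b b0 bP] := hpoly_bound (hp l); exists b.
exists B => [l|P z]; first by case: (BP l).
apply: le_trans (ler_norm_sum _ _ _) _; apply: ler_sum => l _.
by rewrite normrM -mulrA normr_nat ler_wpM2l //; case: (BP l).
Qed.
End polynomial_parts.

Section regularization.
Variables (R : realType) (N : nat) (s beta : R).
Hypotheses (hs : 0 < s) (hbeta : 0 < beta).
Local Notation mu := (lebesgue_measure_rV R N).
Local Notation rV := (lebesgue_rV R N).
Local Notation intg f := (mu.-integrable [set: rV] (EFin \o (f : rV -> R))).
Local Notation K := (N%:R + 2 * s).

Definition subcritical (l : nat) := ~~ odd l && (l%:R < 2 * s).
Definition critical (l : nat) := ~~ odd l && (l%:R == 2 * s).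
Definition supercritical (l : nat) := ~~ odd l && (2 * s < l%:R).

Lemma psum_trichotomy k (p : nat -> 'rV[R]_N -> R) (z : 'rV[R]_N) :
  \sum_(l < k.+1) (~~ odd l)%:R * p l z =
  psum k p subcritical z + psum k p critical z + psum k p supercritical z.
Proof.
rewrite /psum -!big_split /=; apply: eq_bigr => l _; rewrite -!mulrDl -!natrD; congr (_%:R * _).
rewrite /subcritical /critical /supercritical; case: (odd l) => //=.
by case: ltrgtP.
Qed.

(** The Taylor terms of even degree below 2s are removed globally and that of
    degree 2s only in a ball: divided by |z|^(N+2s), the former are integrable
    at infinity but the latter is not integrable either at 0 or at infinity. *)
Definition regularized (k : nat) (p : nat -> 'rV[R]_N -> R) (rho : R) (v : 'rV[R]_N -> R) (z : 'rV[R]_N) : R :=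
  v z - psum k p subcritical z - psum k p critical z * (enorm z <= rho)%R%:R.

(** In the ball, what is left is the Taylor remainder plus the terms of degree
    above 2s; outside of it, v and the terms of degree below 2s. Each is
    dominated by a power of |z| to which one of the two integrability criteria
    applies. *)
Lemma integrable_regularized k (p : nat -> 'rV[R]_N -> R) (C rho : R) v :
  (forall l, hpoly l (p l)) -> 0 < rho <= 1 -> 0 <= C -> measurable_fun [set: rV] (v : rV -> R) ->
  (forall z, enorm z <= rho ->
     `|v z - \sum_(l < k.+1) (~~ odd l)%:R * p l z| <= C * enorm z `^ (2 * s + beta)) ->
  intg (fun z => `|v z| * enorm z `^ (- K) * (enorm z \in `]rho, +oo[)%:R) ->
  intg (fun z => regularized k p rho v z * enorm z `^ (- K)).
Proof.
move=> hp /andP[rho0 rho1] C0 mv vC vi.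
have [B B0 BP] := psum_bound k hp.
have K0 : 0 < K by rewrite ltr_wpDl // mulr_gt0.
pose near_pow (e : R) (z : 'rV[R]_N) : R := enorm z `^ e * (enorm z \in `]0, 1])%:R.
pose far_pow (e : R) (z : 'rV[R]_N) : R := enorm z `^ e * (enorm z \in `]rho, +oo[)%:R.
have near0 e z : 0 <= near_pow e z by rewrite mulr_ge0 ?powR_ge0.
have far0 e z : 0 <= far_pow e z by rewrite mulr_ge0 ?powR_ge0.
(* The exponents 1 and - K are placeholders, integrable at 0 and at infinity, for the terms with coefficient 0. *)
pose e1 l := if supercritical l then l%:R - K else 1.
pose e2 l := if subcritical l then l%:R - K else - K.
pose near_part (z : 'rV[R]_N) := C * near_pow (2 * s + beta - K) z +
   \sum_(l < k.+1) (supercritical l)%:R * B l * near_pow (e1 l) z.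
pose far_part (z : 'rV[R]_N) := `|v z| * enorm z `^ (- K) * (enorm z \in `]rho, +oo[)%:R +
   \sum_(l < k.+1) (subcritical l)%:R * B l * far_pow (e2 l) z.
have near_ge0 z : 0 <= near_part z.
  by apply: addr_ge0; [exact: mulr_ge0|apply: sumr_ge0 => l _; apply: mulr_ge0 => //; apply: mulr_ge0].
have far_ge0 z : 0 <= far_part z.
  by apply: addr_ge0; [rewrite !mulr_ge0 ?powR_ge0|apply: sumr_ge0 => l _; apply: mulr_ge0 => //; apply: mulr_ge0].
apply: (@integrable_dominated _ _ _ (fun z => near_part z + far_part z)).
- apply: measurable_funM; last by apply: (measurableT_comp (measurable_powR (- K))); exact: measurable_enorm.
  apply: measurable_funB; first by apply: measurable_funB => //; exact: measurable_psum.
  apply: measurable_funM; first exact: measurable_psum.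
  rewrite (_ : (fun z => _) = (fun y => (enorm y \in `]-oo, rho])%:R)); first exact: measurable_enorm_in.
  by apply/funext => y; rewrite in_itv.
- move=> z; have [z0|z0] := eqVneq (enorm z) 0.
    (* At the origin the weight is 0, a power of 0 with nonzero exponent. *)
    rewrite z0 powR0 ?oppr_eq0 ?gt_eqF // mulr0 normr0; exact: addr_ge0.
  have zp : 0 < enorm z by rewrite lt_def z0 enorm_ge0.
  have powK e : enorm z `^ e * enorm z `^ (- K) = enorm z `^ (e - K).
    by rewrite -powRD // z0 implybT.
  have powlK (l : nat) : enorm z ^+ l * enorm z `^ (- K) = enorm z `^ (l%:R - K).
    by rewrite -powR_mulrn ?enorm_ge0.
  rewrite normrM [`|_ `^ _|]ger0_norm ?powR_ge0 // /regularized.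
  have [zr|zr] := lerP (enorm z) rho.
    rewrite mulr1 ler_wpDr //.
    have -> : v z - psum k p subcritical z - psum k p critical z =
      (v z - \sum_(l < k.+1) (~~ odd l)%:R * p l z) + psum k p supercritical z.
      by rewrite psum_trichotomy; ring.
    apply: (@le_trans _ _ ((C * enorm z `^ (2 * s + beta) +
       \sum_(l < k.+1) (supercritical l)%:R * B l * enorm z ^+ l) * enorm z `^ (- K))).
      rewrite ler_wpM2r ?powR_ge0 //; apply: le_trans (ler_normD _ _) _.
      by apply: lerD; [exact: vC|exact: BP].
    have z1 : enorm z \in `]0, 1] by rewrite in_itv /= zp (le_trans zr).
    rewrite mulrDl -mulrA powK /near_part /near_pow z1 mulr1 lerD2l mulr_suml.
    apply: ler_sum => l _; rewrite -mulrA powlK /e1 mulr1.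
    by case: ifP => // _; rewrite !mul0r.
  rewrite mulr0 subr0 ler_wpDl //.
  have z1 : enorm z \in `]rho, +oo[ by rewrite in_itv /= zr.
  apply: (@le_trans _ _ ((`|v z| + \sum_(l < k.+1) (subcritical l)%:R * B l * enorm z ^+ l) * enorm z `^ (- K))).
    rewrite ler_wpM2r ?powR_ge0 //; apply: le_trans (ler_normB _ _) _.
    by rewrite lerD2l BP.
  rewrite mulrDl /far_part /far_pow z1 mulr1 lerD2l mulr_suml.
  apply: ler_sum => l _; rewrite -[leLHS]mulrA powlK /e2 mulr1.
  by case: ifP => // _; rewrite !mul0r.
- apply: integrableRD; apply: integrableRD.
  + apply: integrableRZ; apply: integrable_powR_near0.
    have -> : 2 * s + beta - K = beta - N%:R by ring.
    by rewrite ltrDr.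
  + apply: integrableR_sum => l; apply: integrableRZ; apply: integrable_powR_near0.
    rewrite /e1; case: ifP => [/andP[_ sl]|_].
      have -> : l%:R - K = (l%:R - 2 * s) - N%:R by ring.
      by rewrite ltrDr subr_gt0.
    by apply: (@le_lt_trans _ _ 0) => //; rewrite oppr_le0.
  + exact: vi.
  + apply: integrableR_sum => l; apply: integrableRZ; apply: integrable_powR_infty => //.
    rewrite /e2; case: ifP => [/andP[_ sl]|_].
      have -> : l%:R - K = (l%:R - 2 * s) - N%:R by ring.
      by rewrite gtrDr subr_lt0.
    by rewrite ltrN2 ltrDl mulr_gt0.
Qed.
End regularization.

(** * The hypersingular integral *)

Section hypersingular_value.
Variables (R : realType) (N : nat) (s : R).
Hypothesis (hs : 0 < s).
Local Notation mu := (lebesgue_measure_rV R N).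
Local Notation rV := (lebesgue_rV R N).
Local Notation intg f := (mu.-integrable [set: rV] (EFin \o (f : rV -> R))).
Local Notation K := (N%:R + 2 * s).
Variables (u : 'rV[R]_N -> R) (x : 'rV[R]_N).

Definition even_part (z : 'rV[R]_N) : R := (u (x + z) + u (x - z)) / 2.

Let K0 : 0 < K. Proof. by rewrite ltr_wpDl // mulr_gt0. Qed.

Lemma affineN (z : 'rV[R]_N) : affine x (-1) z = x - z.
Proof. by rewrite /affine scaleN1r. Qed.

Lemma affine1 (z : 'rV[R]_N) : affine x 1 z = x + z.
Proof. by rewrite /affine scale1r. Qed.

Lemma measurable_even_part : measurable_fun [set: rV] (u : rV -> R) ->
  measurable_fun [set: rV] (even_part : rV -> R).
Proof.
move=> mu_; apply: measurable_funM; last exact: measurable_cst.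
apply: measurable_funD.
  under eq_fun do rewrite -affine1.
  by apply: measurable_comp_affine; rewrite ?oner_eq0.
under eq_fun do rewrite -affineN.
by apply: measurable_comp_affine; rewrite ?oppr_eq0 ?oner_eq0.
Qed.

(** For |z| > rho, both |x + z| and |x - z| are at most a multiple of |z|, so
    |z|^-K is bounded by a multiple of the weight in L1s at these points. *)
Lemma integrable_even_part_tail (rho : R) : L1s s u -> 0 < rho ->
  intg (fun z => `|even_part z| * enorm z `^ (- K) * (enorm z \in `]rho, +oo[)%R%:R).
Proof.
move=> [[mu_ _] ui] rho0.
pose w (y : 'rV[R]_N) : R := `|u y| / (1 + enorm y `^ K).
have den0 (y : 'rV[R]_N) : 0 < 1 + enorm y `^ K by rewrite ltr_pwDl ?powR_ge0.
have w0 y : 0 <= w y by rewrite divr_ge0 // ltW.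
have mp (e : R) : measurable_fun [set: rV] (fun y : rV => enorm y `^ e : R).
  by apply: (measurableT_comp (measurable_powR e)); exact: measurable_enorm.
have iw : intg w.
  apply/integrableP; split.
    apply/measurable_EFinP; apply: measurable_funM; first exact: measurableT_comp.
    rewrite (_ : (fun y => _) = (fun t : R => t `^ (-1)) \o (fun y => 1 + enorm y `^ K)); last first.
      by apply/funext => y /=; rewrite powR_inv1 // ltW.
    apply: (measurableT_comp (measurable_powR (-1))).
    by apply: measurable_funD => //; exact: mp.
  under eq_integral do rewrite /= ger0_norm ?w0 //.
  exact: ui.
(* For rho < |z| = |z'| one has |x + z'| <= 2 (|x| + |z|) <= B |z|, and also 1 <= rho^-K |z|^K. *)
pose B := 2 * (enorm x / rho + 1).
have B0 : 0 <= B by rewrite mulr_ge0 // addr_ge0 // divr_ge0 ?enorm_ge0 // ltW.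
pose M := rho `^ (- K) + B `^ K.
have key (z' z : 'rV[R]_N) : rho < enorm z -> enorm z' = enorm z -> `|u (x + z')| * enorm z `^ (- K) <= M * w (x + z').
  move=> rz zz; have z0 : 0 < enorm z := lt_trans rho0 rz.
  rewrite /w mulrCA ler_wpM2l // ler_pdivlMr // powRN ler_pdivrMl ?powR_gt0 //.
  rewrite /M mulrDr; apply: lerD.
    rewrite mulrC powRN ler_pdivlMl ?powR_gt0 // mulr1.
    by rewrite ge0_ler_powR ?nnegrE ?ltW.
  have zB : 0 <= enorm z * B by rewrite mulr_ge0 ?enorm_ge0.
  rewrite -powRM ?enorm_ge0 // ge0_ler_powR ?nnegrE ?enorm_ge0 ?(ltW K0) //.
  apply: le_trans (enormD_le _ _) _; rewrite zz /B mulrCA ler_wpM2l //.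
  by rewrite mulrDr mulr1 lerD2r mulrCA ler_peMr ?enorm_ge0 // ler_pdivlMr // mul1r ltW.
apply: (@integrable_dominated _ _ _ (fun z => M * (w (affine x 1 z) + w (affine x (-1) z)))).
- apply: measurable_funM; last exact: measurable_enorm_in.
  apply: measurable_funM; last exact: mp.
  exact: (measurableT_comp _ (measurable_even_part mu_)).
- move=> z; have M0 : 0 <= M by rewrite addr_ge0 ?powR_ge0.
  rewrite in_itv /= andbT; case: (boolP (rho < enorm z)) => [rz|_]; last first.
    by rewrite mulr0 normr0; apply: mulr_ge0 => //; apply: addr_ge0.
  rewrite mulr1 normrM normr_id [`|_ `^ _|]ger0_norm ?powR_ge0 // affine1 affineN mulrDr.
  have h1 := key z z rz erefl; have h2 := key (- z) z rz (enormN z).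
  apply: le_trans (lerD h1 h2); rewrite -mulrDl ler_wpM2r ?powR_ge0 //.
  rewrite /even_part normrM normfV (@ger0_norm _ 2) // ler_pdivrMr //.
  apply: le_trans (ler_normD _ _) _.
  by rewrite ler_peMr ?addr_ge0 // ler1n.
- by apply: integrableRZ; apply: integrableRD; apply: integrable_affine; rewrite ?oppr_eq0 ?oner_eq0.
Qed.

Lemma delta_even_part (m : nat) y : delta m u x y =
  'C(2 * m, m)%:R * u x + 2 * \sum_(1 <= k < m.+1) symm_coef R m k * even_part (k%:R *: y).
Proof.
rewrite delta_symm mulr_sumr; congr +%R; apply: eq_bigr => k _.
by rewrite /even_part; field.
Qed.

Lemma subcritical_moment (m l : nat) : s < m%:R -> subcritical s l ->
  2 * \sum_(1 <= k < m.+1) symm_coef R m k * k%:R ^+ l = - ('C(2 * m, m)%:R * (l == 0)%N%:R).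
Proof.
move=> sm /andP[lo ls].
have lE : l = (2 * l./2)%N by rewrite mul2n even_halfK.
have jm : (l./2 < m)%N.
  rewrite -(ltr_nat R); apply: le_lt_trans sm; rewrite -(ler_pM2l (_ : 0 < 2)) //.
  by rewrite -natrM -lE ltW.
have := symm_coef_moment R jm; rewrite -lE => /eqP; rewrite addrC addr_eq0 => /eqP.
rewrite -mulr_natl => ->; rewrite -[X in - X]mulr_natr; congr (- (_ * _%:R)).
by rewrite [in RHS]lE mul2n double_eq0.
Qed.

Lemma critical_psum_scale (k : nat) (p : nat -> 'rV[R]_N -> R) (j : nat) y :
  (forall l, hpoly l (p l)) -> (0 < j)%N ->
  psum k p (critical s) (j%:R *: y) = j%:R `^ (2 * s) * psum k p (critical s) y.
Proof.
move=> hp j0; rewrite psum_homogeneous // mulr_sumr; apply: eq_bigr => l _.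
rewrite mulrCA mulrA; case: (boolP (critical s l)) => [/andP[_ /eqP <-]|_].
  by rewrite powR_mulrn.
by rewrite !mul0r.
Qed.

(** By the vanishing moments the Taylor terms of degree below 2s drop out of
    the difference, the constant term cancelling against the central value. *)
Lemma delta_regularized (k m : nat) (p : nat -> 'rV[R]_N -> R) (rho : R) y : (forall l, hpoly l (p l)) ->
  (forall z, p 0%N z = u x) -> s < m%:R ->
  delta m u x y =
  2 * (\sum_(1 <= j < m.+1) symm_coef R m j * regularized s k p rho even_part (j%:R *: y)) +
  2 * (psum k p (critical s) y * \sum_(1 <= j < m.+1) symm_coef R m j * (j%:R `^ (2 * s) * (j%:R * enorm y <= rho)%R%:R)).
Proof.
move=> hp p0 sm; rewrite delta_even_part.
have sub : 2 * \sum_(1 <= j < m.+1) symm_coef R m j * psum k p (subcritical s) (j%:R *: y) =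
    - ('C(2 * m, m)%:R * u x).
  under eq_bigr do rewrite psum_homogeneous // mulr_sumr.
  have term (l : nat) : 2 * \sum_(1 <= j < m.+1) symm_coef R m j * ((subcritical s l)%:R * j%:R ^+ l * p l y) =
      - ('C(2 * m, m)%:R * (l == 0)%N%:R) * ((subcritical s l)%:R * p l y).
    case: (boolP (subcritical s l)) => sl; last first.
      by rewrite big1 ?mul0r ?mulr0 // => j _; rewrite !mul0r mulr0.
    rewrite -(subcritical_moment sm sl) -mulrA mulr_suml; congr (_ * _).
    by apply: eq_bigr => j _; ring.
  rewrite exchange_big /= mulr_sumr; under eq_bigr do rewrite term.
  rewrite big_ord_recl /= big1 => [|l _]; last by rewrite mulr0 oppr0 mul0r.
  by rewrite /subcritical /= mulr_gt0 // p0 mulr1 mul1r addr0 mulNr.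
have -> : \sum_(1 <= j < m.+1) symm_coef R m j * even_part (j%:R *: y) =
  \sum_(1 <= j < m.+1) symm_coef R m j * regularized s k p rho even_part (j%:R *: y) +
  \sum_(1 <= j < m.+1) symm_coef R m j * psum k p (subcritical s) (j%:R *: y) +
  psum k p (critical s) y * \sum_(1 <= j < m.+1) symm_coef R m j * (j%:R `^ (2 * s) * (j%:R * enorm y <= rho)%R%:R).
  rewrite mulr_sumr -!big_split /=; apply: eq_big_nat => j /andP[j0 _].
  rewrite /regularized critical_psum_scale // enormZ ger0_norm //; ring.
by rewrite !mulrDr sub; ring.
Qed.

Lemma Rintegral_sum_nat1 (m : nat) (b : nat -> R) (F : nat -> rV -> R) :
  (forall j, (0 < j)%N -> intg (F j)) ->
  \int[mu]_y (\sum_(1 <= j < m.+1) b j * F j y) = \sum_(1 <= j < m.+1) b j * \int[mu]_y F j y.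
Proof.
move=> iF; rewrite big_add1 /= -(@Rintegral_sumZ R N nat _ (fun j => b j.+1) (fun j => F j.+1)).
  by apply: eq_Rintegral => y _; rewrite big_add1.
by move=> j; exact: iF.
Qed.

Lemma integrable_sum_nat1 (m : nat) (b : nat -> R) (F : nat -> rV -> R) :
  (forall j, (0 < j)%N -> intg (F j)) ->
  intg (fun y => \sum_(1 <= j < m.+1) b j * F j y).
Proof.
move=> iF; under eq_fun do rewrite big_add1.
by apply: integrableR_sum => j; apply: integrableRZ; exact: iF.
Qed.

Definition hypersingular_integral (m : nat) : R :=
  \int[mu]_y (delta m u x y / enorm y `^ K).

Definition symm_powR_sum (m : nat) : R :=
  \sum_(1 <= k < m.+1) symm_coef R m k * k%:R `^ (2 * s).

Definition symm_ln_sum (m : nat) : R :=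
  \sum_(1 <= k < m.+1) symm_coef R m k * k%:R `^ (2 * s) * ln k%:R.

Lemma scaled_integral (f : 'rV[R]_N -> R) (j : nat) : (0 < j)%N ->
  intg (fun z => f z * enorm z `^ (- K)) ->
  intg (fun y => f (j%:R *: y) * enorm y `^ (- K)) /\
  \int[mu]_y (f (j%:R *: y) * enorm y `^ (- K)) =
    j%:R `^ (2 * s) * \int[mu]_z (f z * enorm z `^ (- K)).
Proof.
move=> j0 fi; have jN : j%:R != 0 :> R by rewrite pnatr_eq0 -lt0n.
pose F (z : rV) := f z * enorm z `^ (- K).
have E : (fun y : rV => f (j%:R *: y) * enorm y `^ (- K)) =
    (fun y : rV => j%:R `^ K * F (affine 0 j%:R y)).
  apply/funext => y; rewrite /F /affine add0r enormZ ger0_norm // mulrCA; congr (_ * _).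
  rewrite powRM ?enorm_ge0 // mulrA -powRD; last by rewrite jN implybT.
  by rewrite addrN powRr0 mul1r.
have iF : intg F by [].
have Ei : intg (fun y => F (affine 0 j%:R y)) by exact: integrable_affine.
rewrite E; split; first exact: integrableRZ.
rewrite (RintegralZl _ measurableT Ei) (Rintegral_affine 0 jN iF) mulrA.
congr (_ * _).
rewrite ger0_norm // powRD; last by rewrite jN implybT.
by rewrite powR_mulrn // mulrAC mulfV ?mul1r // expf_neq0.
Qed.

Lemma symm_powR_sum_nat (m : nat) : s \is a Num.nat -> s < m%:R -> symm_powR_sum m = 0.
Proof.
move=> /natrP[l sl] sm; have l0 : (0 < l)%N by rewrite -(ltr_nat R) -sl.
have lm : (l < m)%N by rewrite -(ltr_nat R) -sl.
have := symm_coef_moment R lm; rewrite eqn0Ngt l0 add0r => /eqP.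
rewrite mulrn_eq0 /= => /eqP E; rewrite -[RHS]E /symm_powR_sum.
by apply: eq_bigr => k _; rewrite sl -natrM powR_mulrn.
Qed.

(** For integral s, the sum of a_k k^(2s) vanishes, so the cut-offs at
    k |y| <= rho in delta_regularized may be replaced by minus the indicators
    of the shells |y| <= rho < k |y|, away from the singularity. *)
Lemma hypersingular_integralE (U : set 'rV[R]_N) (beta : R) :
  open U -> U x -> 0 < beta -> Ct (2 * s + beta) U u -> L1s s u ->
  exists W c, (s \isn't a Num.nat -> c = 0) /\
    forall m, s < m%:R -> hypersingular_integral m =
      2 * (symm_powR_sum m * W) - 2 * (c * symm_ln_sum m).
Proof.
move=> Uo Ux b0 uC uL.
have [k [p [C [r [_ hp p0 r0 [C0 pP]]]]]] := even_part_taylor Uo Ux uC.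
(* Half of the radius makes the closed ball of radius rho part of the open ball where the expansion holds. *)
pose rho := Num.min (r / 2) 1.
have rho01 : 0 < rho <= 1.
  apply/andP; split; last by rewrite ge_min lexx orbT.
  by rewrite lt_min ltr01 andbT divr_gt0.
have rhor : rho < r by rewrite gt_min; apply/orP; left; lra.
have mv := measurable_even_part uL.1.1.
pose w := regularized s k p rho even_part.
have iw : intg (fun z => w z * enorm z `^ (- K)).
  apply: (@integrable_regularized _ _ s beta hs b0 k p C rho) => //.
    by move=> z zr; apply: pP; exact: le_lt_trans rhor.
  by apply: integrable_even_part_tail => //; case/andP: rho01.
pose h (y : 'rV[R]_N) := psum k p (critical s) y * enorm y `^ (- K).
have [B B0 BP] := psum_bound k hp.
pose Ch := \sum_(l < k.+1) (critical s l)%:R * B l.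
have hB y : `|h y| <= Ch * enorm y `^ (- N%:R).
  have [y0|y0] := eqVneq (enorm y) 0.
    rewrite /h y0 [X in _ * X]powR0 ?oppr_eq0 ?gt_eqF // mulr0 normr0.
    by rewrite mulr_ge0 ?powR_ge0 // sumr_ge0 // => l _; rewrite mulr_ge0.
  rewrite /h normrM [`|_ `^ _|]ger0_norm ?powR_ge0 //.
  apply: le_trans (ler_wpM2r (powR_ge0 _ _) (BP _ _)) _.
  rewrite !mulr_suml; apply: ler_sum => l _; case: (boolP (critical s l)) => [/andP[_ /eqP ls]|_].
    rewrite -[leLHS]mulrA -powR_mulrn ?enorm_ge0 // ls -powRD ?y0 ?implybT //.
    by have -> : 2 * s - K = - N%:R by ring.
  by rewrite !mul0r.
have mh : measurable_fun [set: rV] (h : rV -> R).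
  apply: measurable_funM; first exact: measurable_psum.
  by apply: (measurableT_comp (measurable_powR (- K))); exact: measurable_enorm.
have hh (j : nat) y : (0 < j)%N -> h (j%:R *: y) = j%:R ^- N * h y.
  move=> j0; have jN : j%:R != 0 :> R by rewrite pnatr_eq0 -lt0n.
  rewrite /h critical_psum_scale // enormZ ger0_norm // powRM ?enorm_ge0 //.
  rewrite mulrACA -powRD ?jN ?implybT //; congr (_ * _).
  have -> : 2 * s - K = - N%:R by ring.
  by rewrite powRN powR_mulrn.
have rho0 : 0 < rho by case/andP: rho01.
have ish := integrable_log_shell rho0 mh hB.
have h0 : s \isn't a Num.nat -> forall y, h y = 0.
  move=> sN y; rewrite /h /psum big1 ?mul0r // => l _; rewrite /critical.
  case: eqP => [ls|_]; last by rewrite andbF mul0r.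
  case: (boolP (odd l)) => /= [_|lo]; first by rewrite mul0r.
  case/negP: sN; apply/natrP; exists l./2.
  have : (2 : R) * s = 2 * l./2%:R by rewrite -ls -natrM mul2n even_halfK.
  by move/mulfI; apply.
have [c [cN cP]] : exists c, (s \isn't a Num.nat -> c = 0) /\ forall j : nat, (0 < j)%N ->
    \int[mu]_y (h y * (enorm y <= rho < j%:R * enorm y)%R%:R) = c * ln j%:R.
  case: (boolP (s \is a Num.nat)) => sN.
    by have [c cP] := Rintegral_log_shell rho0 mh hB hh; exists c.
  exists 0; split => // j j0; under eq_Rintegral do rewrite h0 // mul0r.
  by rewrite Rintegral_cst // !mul0r.
exists (\int[mu]_z (w z * enorm z `^ (- K))), c; split => // m sm.
have pt (y : rV) : delta m u x y / enorm y `^ K =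
    2 * (\sum_(1 <= j < m.+1) symm_coef R m j * (w (j%:R *: y) * enorm y `^ (- K))) +
    (- 2) * (\sum_(1 <= j < m.+1) (symm_coef R m j * j%:R `^ (2 * s)) * (h y * (enorm y <= rho < j%:R * enorm y)%R%:R)).
  rewrite (delta_regularized k rho y hp p0 sm) -powRN mulrDl -!mulrA; congr (_ + _).
    rewrite mulr_suml; congr (_ * _); apply: eq_bigr => j _; by rewrite mulrA.
  rewrite mulNr -mulrN; congr (_ * _); rewrite [LHS]mulrCA -/(h y) [LHS]mulrC.
  case: (boolP (s \is a Num.nat)) => [sN|/h0 hy]; last first.
    by rewrite hy mul0r big1 ?oppr0 // => j _; rewrite mul0r mulr0.
  have := symm_powR_sum_nat sN sm; rewrite /symm_powR_sum => S0.
  apply/eqP; rewrite -addr_eq0 mulr_sumr -big_split /=; apply/eqP.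
  transitivity (h y * (enorm y <= rho)%R%:R *
      \sum_(1 <= j < m.+1) symm_coef R m j * j%:R `^ (2 * s)); last by rewrite S0 mulr0.
  rewrite mulr_sumr.
  apply: eq_big_nat => j /andP[j0 _].
  have -> : (enorm y <= rho)%R%:R = (j%:R * enorm y <= rho)%R%:R + (enorm y <= rho < j%:R * enorm y)%R%:R :> R.
    have yj : enorm y <= j%:R * enorm y by rewrite ler_peMl ?enorm_ge0 // ler1n.
    rewrite -natrD; congr (_%:R).
    by case: (lerP (enorm y) rho); case: (lerP (j%:R * enorm y) rho) => //= *; exfalso; lra.
  by ring.
rewrite /hypersingular_integral; under eq_Rintegral do rewrite pt.
have i1 j (j0 : (0 < j)%N) := (scaled_integral j0 iw).1.
have e1 j (j0 : (0 < j)%N) := (scaled_integral j0 iw).2.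
rewrite RintegralD //; last 2 first.
- by apply: integrableRZ; exact: (integrable_sum_nat1 _ _ i1).
- by apply: integrableRZ; exact: (integrable_sum_nat1 _ _ ish).
rewrite !RintegralZl //; last 2 first.
- exact: (integrable_sum_nat1 _ _ ish).
- exact: (integrable_sum_nat1 _ _ i1).
rewrite (Rintegral_sum_nat1 _ _ i1) (Rintegral_sum_nat1 _ _ ish) mulNr.
congr (2 * _ - 2 * _).
  rewrite /symm_powR_sum mulr_suml; apply: eq_big_nat => j /andP[j0 _].
  by rewrite e1 // mulrA.
rewrite /symm_ln_sum mulr_sumr; apply: eq_big_nat => j /andP[j0 _].
by rewrite cP // mulrCA.
Qed.

End hypersingular_value.

(** * Independence of the order of the difference *)

(** Exactly one of the two sums survives in the value of the integral, and it
    is the one, up to a sign independent of m, whose inverse occurs in the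
    constant. *)
Lemma cNms_hypersingular (R : realType) (N : nat) (s W c : R) :
  0 < s -> (s \isn't a Num.nat -> c = 0) ->
  exists L, forall m (I : R), s < m%:R ->
    I = 2 * (symm_powR_sum s m * W) - 2 * (c * symm_ln_sum s m) ->
    cNms N m s / 2 * I = L.
Proof.
move=> s0 cN; case: (boolP (s \is a Num.nat)) => [sN|sN].
- set l := Num.truncn s; have sl : s = l%:R by rewrite /l truncnK.
  have l0 : (0 < l)%N by rewrite -(ltr_nat R) -sl.
  exists (4 `^ s * Gamma (N%:R / 2 + s) * (l`!)%:R / (2 * pi `^ (N%:R / 2)) *
    ((-1) ^ (1 - l%:Z))^-1 * - c) => m I sm ->.
  have lm : (l < m)%N by rewrite -(ltr_nat R) -sl.
  rewrite symm_powR_sum_nat // mul0r mulr0 sub0r /cNms sN -/l.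
  have TE : \sum_(2 <= k < m.+1) (-1) ^ (k%:Z - l%:Z + 1) * 'C(2 * m, m - k)%:R *
       k%:R `^ (2 * s) * ln k%:R = (-1) ^ (1 - l%:Z) * symm_ln_sum s m.
    rewrite /symm_ln_sum [in RHS]big_ltn; last by lia.
    rewrite ln1 mulr0 add0r.
    rewrite mulr_sumr; apply: eq_bigr => k _.
    have -> : k%:Z - l%:Z + 1 = (1 - l%:Z) + k%:Z by lia.
    rewrite expfzDr ?oppr_eq0 ?oner_eq0 // -exprnP /symm_coef; ring.
  have T0 : symm_ln_sum s m != 0 by rewrite /symm_ln_sum sl; apply: symm_coef_ln_neq0; rewrite l0.
  have e0 : (-1) ^ (1 - l%:Z) != 0 :> R by rewrite expfz_neq0 // oppr_eq0 oner_eq0.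
  rewrite TE; move: T0 e0; set T := symm_ln_sum _ _; set e := _ ^ _; set A := 4 `^ s * _ * _ / _ => T0 e0.
  by field; rewrite T0 e0.
- exists (4 `^ s * Gamma (N%:R / 2 + s) / (pi `^ (N%:R / 2) * Gamma (- s)) * W) => m I sm ->.
  rewrite cN // mul0r mulr0 subr0 /cNms (negbTE sN).
  have S0 : symm_powR_sum s m != 0 by apply: symm_coef_powR_neq0; rewrite ?s0.
  move: S0; rewrite /symm_powR_sum; set S := \sum_(1 <= k < _) _; set A := 4 `^ s * _ / _ => S0.
  by field.
Qed.

Unset Implicit Arguments.

Theorem lemma1p3 (R : realType) (N : nat) (hN : (0 < N)%N)
    (U : set 'rV[R]_N) (hU : open U) (s beta : R) (hs : 0 < s) (hbeta : 0 < beta)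
    (u : 'rV[R]_N -> R) (hC : Ct (2 * s + beta) U u) (hL : L1s s u) :
  forall m n : nat, (n < m)%N -> s < n%:R ->
    forall x, U x -> Lms m s u x = Lms n s u x.
Proof.
move=> m n nm sn x Ux.
have sm : s < m%:R by apply: lt_trans sn _; rewrite ltr_nat.
have [W [c [c0 E]]] := hypersingular_integralE hs hU Ux hbeta hC hL.
have [L LP] := cNms_hypersingular N W hs c0.
by rewrite /Lms (LP m _ sm (E m sm)) (LP n _ sn (E n sn)).
Qed.
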